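(* Let $0<\alpha\leq 1$, let $\beta\in\mathbb{R}$, and let $p$ be an analytic function on $\mathbb{D}$ with $p(0)=1$ satisfying $$1+\beta\,\frac{zp'(z)}{p(z)}\prec\varphi_{CAR}(z).$$ If $|\beta|\geq\frac{1}{\alpha}\sqrt{\frac{4\sqrt{3}+8}{3\sqrt{3}}}\ (\simeq 1.6947/\alpha)$, then $p(z)\prec\left(\frac{1+z}{1-z}\right)^{\alpha}$.
   Context: $\mathbb{D}$ is the open unit disc in $\mathbb{C}$. $\varphi_{CAR}(z)=1+\frac{4z}{3}+\frac{2z^2}{3}$. For analytic functions $f,g$ on $\mathbb{D}$, $f\prec g$ ($f$ is subordinate to $g$) means there is an analytic $w:\mathbb{D}\to\mathbb{D}$ with $w(0)=0$ and $f(z)=g(w(z))$ for all $z\in\mathbb{D}$; in particular a subordination hypothesis includes that its left-hand side is analytic on $\mathbb{D}$. The power $\left(\frac{1+z}{1-z}\right)^{\alpha}$ is the principal branch (value $1$ at $z=0$). *)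

(* Defs.v *)
From Stdlib Require Import Reals Lra.
From Coquelicot Require Import Coquelicot.
Open Scope R_scope.

Definition in_disc (z : C) : Prop := Cmod z < 1.

(* Analytic means complex differentiable at every point of the open disc;
   values of [f] outside the disc play no role, since the disc is open. *)
Definition analytic_on_disc (f : C -> C) : Prop :=
  forall z : C, in_disc z ->
    ex_derive (K := C_AbsRing) (V := C_NormedModule) f z.

Definition subordinate (f g : C -> C) : Prop :=
  analytic_on_disc f /\ analytic_on_disc g /\
  exists w : C -> C,
    analytic_on_disc w /\
    (forall z : C, in_disc z -> in_disc (w z)) /\
    w (RtoC 0) = RtoC 0 /\
    (forall z : C, in_disc z -> f z = g (w z)).

Definition phi_CAR (z : C) : C :=
  (1 + 4 * z / 3 + 2 * z ^ 2 / 3)%C.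

(* Principal argument, in (-PI, PI], for z <> 0. *)
Definition Carg (z : C) : R :=
  if Rle_dec 0 (Im z) then acos (Re z / Cmod z) else - acos (Re z / Cmod z).

Definition Cln (z : C) : C := (ln (Cmod z), Carg z).

Definition Cexp (z : C) : C :=
  (exp (Re z) * cos (Im z), exp (Re z) * sin (Im z)).

(* Principal branch of z^a for z <> 0; the value at 0 carries no meaning. *)
Definition Cpower (z : C) (a : R) : C := Cexp (RtoC a * Cln z).

(* Main.v *)
Require Import Defs.
From Stdlib Require Import Reals Lra Psatz ClassicalEpsilon.
From Coquelicot Require Import Coquelicot.
Open Scope R_scope.

(** Put [q z = z p'(z) / p(z)]. By hypothesis [beta q = phi_CAR(w) - 1], so [|q| <= 2], which keeps [p]
    away from [0]; and where [Re q = 0] one has [|Im q| < alpha], since the curve [phi_CAR (|w| = 1)]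
    meets the line [Re = 1] at [1 +- i K], with [K^2] the constant under the square root.

    If [p] left the sector [|arg p| < alpha pi / 2], consider a point [z0] of least modulus where this
    happens, and [W = (p^(1/alpha) - 1) / (p^(1/alpha) + 1)], so that [|W| <= 1] on [|z| <= |z0|] and
    [|W z0| = 1]. By Jack's lemma [z0 W'(z0) = m W(z0)] with [m >= 1], and since
    [z W' = (1 - W^2) q / (2 alpha)] this forces [Re q(z0) = 0] and [|Im q(z0)| >= alpha].

    Complex differentiability is all that is known, and no Cauchy theory is used: the identity
    [p' = q p / z] makes [p], hence [W], twice differentiable away from [0], so the Schwarz lemma for
    [W] follows from the second-derivative test applied to
    [|W(z)/z|^2 + eps (ln |z| + |z|^2)] on an annulus. *)

(** * Complex differentiability *)

(** The codomain is [C] as a module over itself, the form that suits products and composites;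
    [cderiv_is_derive] translates to the structure used in [analytic_on_disc]. *)
Definition cderiv (f : C -> C) (z l : C) : Prop :=
  is_derive (K := C_AbsRing) (V := AbsRing_NormedModule C_AbsRing) f z l.

Definition ccont (f : C -> C) (z : C) : Prop :=
  forall eps, 0 < eps -> exists d, 0 < d /\
    forall u, Cmod (u - z) < d -> Cmod (f u - f z) < eps.

Lemma cderiv_eps (f : C -> C) (z l : C) :
  cderiv f z l <->
  (forall eps, 0 < eps -> exists d, 0 < d /\ forall u, Cmod (u - z) < d ->
     Cmod (f u - f z - l * (u - z)) <= eps * Cmod (u - z)).
Proof.
  split.
  - intros [_ H] eps Heps.
    destruct (H z (fun P HP => HP) (mkposreal eps Heps)) as [d Hd].
    exists d; split; [apply cond_pos|].
    intros u Hu. specialize (Hd u Hu).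
    replace (f u - f z - l * (u - z))%C with
      (minus (minus (f u) (f z)) (scal (minus u z) l) : C_AbsRing).
    exact Hd.
    unfold minus, plus, opp, scal; simpl. unfold mult; simpl. ring.
  - intros H. split.
    apply (is_linear_scal_l (K := C_AbsRing) (V := AbsRing_NormedModule C_AbsRing)).
    intros x Hx eps.
    assert (x = z).
    { symmetry. exact (is_filter_lim_locally_unique (V := AbsRing_NormedModule C_AbsRing) z x Hx). }
    subst x.
    destruct (H eps (cond_pos eps)) as [d [Hd0 Hd]].
    exists (mkposreal d Hd0). intros u Hu.
    specialize (Hd u Hu).
    replace (f u - f z - l * (u - z))%C with
      (minus (minus (f u) (f z)) (scal (minus u z) l) : C_AbsRing) in Hd.
    exact Hd.
    unfold minus, plus, opp, scal; simpl. unfold mult; simpl. ring.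
Qed.

(** Both structures on the codomain have the norm [Cmod], so the error estimate carries over
    verbatim and only linearity is restated. *)
Lemma cderiv_is_derive (f : C -> C) (z l : C) :
  cderiv f z l <-> is_derive (K := C_AbsRing) (V := C_NormedModule) f z l.
Proof.
  split; intros [H1 H2]; split.
  - apply (is_linear_scal_l (K := C_AbsRing) (V := C_NormedModule)).
  - exact H2.
  - apply (is_linear_scal_l (K := C_AbsRing) (V := AbsRing_NormedModule C_AbsRing)).
  - exact H2.
Qed.

Lemma cderiv_ccont (f : C -> C) (z l : C) : cderiv f z l -> ccont f z.
Proof.
  intros H eps Heps.
  apply cderiv_eps with (eps := 1) in H; [|lra].
  destruct H as [d [Hd H]].
  assert (0 < 1 + Cmod l) by (pose proof (Cmod_ge_0 l); lra).
  exists (Rmin d (eps / (1 + Cmod l))). split.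
  { apply Rmin_glb_lt; auto. apply Rdiv_lt_0_compat; lra. }
  intros u Hu.
  assert (Hu1 := Rlt_le_trans _ _ _ Hu (Rmin_l _ _)).
  assert (Hu2 := Rlt_le_trans _ _ _ Hu (Rmin_r _ _)).
  specialize (H u Hu1).
  replace (f u - f z)%C with ((f u - f z - l * (u - z)) + l * (u - z))%C by ring.
  eapply Rle_lt_trans. apply Cmod_triangle. rewrite Cmod_mult.
  apply Rlt_div_r in Hu2; lra.
Qed.

Lemma cderiv_plus (f g : C -> C) (z a b : C) :
  cderiv f z a -> cderiv g z b -> cderiv (fun u => f u + g u)%C z (a + b)%C.
Proof.
  intros Hf Hg.
  exact (is_derive_plus (K := C_AbsRing) (V := AbsRing_NormedModule C_AbsRing)
           f g z a b Hf Hg).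
Qed.

Lemma cderiv_mult (f g : C -> C) (z a b : C) :
  cderiv f z a -> cderiv g z b ->
  cderiv (fun u => f u * g u)%C z (a * g z + f z * b)%C.
Proof.
  intros Hf Hg.
  exact (is_derive_mult (K := C_AbsRing) f g z a b Hf Hg Cmult_comm).
Qed.

Lemma cderiv_comp (f g : C -> C) (z a b : C) :
  cderiv f (g z) a -> cderiv g z b -> cderiv (fun u => f (g u)) z (a * b)%C.
Proof.
  intros Hf Hg. rewrite Cmult_comm.
  exact (is_derive_comp (K := C_AbsRing) (V := AbsRing_NormedModule C_AbsRing)
           f g z a b Hf Hg).
Qed.

Lemma cderiv_const (c z : C) : cderiv (fun _ => c) z (RtoC 0).
Proof.
  exact (is_derive_const (K := C_AbsRing) (V := AbsRing_NormedModule C_AbsRing) c z).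
Qed.

Lemma cderiv_id (z : C) : cderiv (fun u => u) z (RtoC 1).
Proof. exact (is_derive_id (K := C_AbsRing) z). Qed.

Lemma cderiv_ext_loc (f g : C -> C) (z l : C) (d : R) :
  0 < d -> (forall u, Cmod (u - z) < d -> f u = g u) ->
  cderiv f z l -> cderiv g z l.
Proof.
  intros Hd H Hf.
  apply (is_derive_ext_loc (K := C_AbsRing) (V := AbsRing_NormedModule C_AbsRing) f g z l);
    auto.
  exists (mkposreal d Hd). intros u Hu. apply H. exact Hu.
Qed.

Lemma cderiv_eq (f : C -> C) (z a b : C) : cderiv f z a -> a = b -> cderiv f z b.
Proof. intros H <-. exact H. Qed.

Lemma cderiv_opp (f : C -> C) (z a : C) :
  cderiv f z a -> cderiv (fun u => - f u)%C z (- a)%C.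
Proof.
  intros H.
  exact (is_derive_opp (K := C_AbsRing) (V := AbsRing_NormedModule C_AbsRing) f z a H).
Qed.

Lemma cderiv_minus (f g : C -> C) (z a b : C) :
  cderiv f z a -> cderiv g z b -> cderiv (fun u => f u - g u)%C z (a - b)%C.
Proof. intros Hf Hg. apply cderiv_plus; auto. apply cderiv_opp; auto. Qed.

Lemma Cmod_le_plus (a b : C) : Cmod a <= Cmod b + Cmod (a - b).
Proof.
  replace a with (b + (a - b))%C at 1 by ring. apply Cmod_triangle.
Qed.

Lemma Cmod_sub_sym (a b : C) : Cmod (a - b) = Cmod (b - a).
Proof. rewrite <- Cmod_opp. f_equal. ring. Qed.

Lemma ccont_nonzero (f : C -> C) (z : C) :
  ccont f z -> f z <> RtoC 0 -> exists d, 0 < d /\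
    forall u, Cmod (u - z) < d -> Cmod (f z) / 2 <= Cmod (f u).
Proof.
  intros H Hz. apply Cmod_gt_0 in Hz.
  destruct (H (Cmod (f z) / 2)) as [d [Hd H']]; [lra|].
  exists d; split; auto. intros u Hu. specialize (H' u Hu).
  pose proof (Cmod_le_plus (f z) (f u)). rewrite Cmod_sub_sym in H0. lra.
Qed.

Lemma cderiv_Cinv (z : C) : z <> RtoC 0 -> cderiv Cinv z (- / (z * z))%C.
Proof.
  intros Hz. apply cderiv_eps. intros eps Heps.
  destruct (ccont_nonzero (fun u => u) z) as [d [Hd H]]; auto.
  { intros e He. exists e; auto. }
  assert (Hm := proj1 (Cmod_gt_0 z) Hz).
  set (m := Cmod z) in *.
  assert (Hm3 : 0 < m * m * m) by (repeat apply Rmult_lt_0_compat; lra).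
  (* The remainder is [(u - z)^2 / (u z^2)]; with [|u| >= m / 2] it is at most
     [2 |u - z|^2 / m^3]. *)
  exists (Rmin d (eps * (m * m * m) / 2)). split.
  { apply Rmin_glb_lt; auto. nra. }
  intros u Hu.
  assert (Hu1 := Rlt_le_trans _ _ _ Hu (Rmin_l _ _)).
  assert (Hu2 := Rlt_le_trans _ _ _ Hu (Rmin_r _ _)).
  specialize (H u Hu1). fold m in H.
  assert (Hu0 : u <> RtoC 0) by (apply Cmod_gt_0; lra).
  replace (/ u - / z - - / (z * z) * (u - z))%C
    with ((u - z) * ((u - z) / (u * (z * z))))%C by (field; auto).
  rewrite Cmod_mult, Cmod_div by (repeat apply Cmult_neq_0; auto).
  rewrite !Cmod_mult. fold m.
  rewrite Rmult_comm. apply Rmult_le_compat_r. apply Cmod_ge_0.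
  assert (0 < Cmod u * (m * m)) by (repeat apply Rmult_lt_0_compat; lra).
  apply Rle_div_l; auto.
  assert (m / 2 * (m * m) <= Cmod u * (m * m)) by (apply Rmult_le_compat_r; nra).
  nra.
Qed.

Lemma cderiv_inv (f : C -> C) (z a : C) :
  cderiv f z a -> f z <> RtoC 0 ->
  cderiv (fun u => / f u)%C z (- a / (f z * f z))%C.
Proof.
  intros H Hz. eapply cderiv_eq.
  exact (cderiv_comp Cinv f z _ _ (cderiv_Cinv (f z) Hz) H).
  field. auto.
Qed.

Lemma cderiv_div (f g : C -> C) (z a b : C) :
  cderiv f z a -> cderiv g z b -> g z <> RtoC 0 ->
  cderiv (fun u => f u / g u)%C z ((a * g z - f z * b) / (g z * g z))%C.
Proof.
  intros Hf Hg H0. eapply cderiv_eq.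
  exact (cderiv_mult _ _ _ _ _ Hf (cderiv_inv g z b Hg H0)).
  simpl; field. auto.
Qed.

(** With [D = g u - g z] and [h = u - z], differentiability of [f] gives [|h - l D| <= e |D|]. For
    [e <= |l| / 2] this forces [|D| <= 2 |h| / |l|], so the error [|D - h / l| = |h - l D| / |l|] is
    of order [e |h|]. *)
Lemma cderiv_inverse (f g : C -> C) (z l : C) (r : R) :
  0 < r -> (forall u, Cmod (u - z) < r -> f (g u) = u) ->
  ccont g z -> cderiv f (g z) l -> l <> RtoC 0 -> cderiv g z (/ l)%C.
Proof.
  intros Hr Hfg Hg Hf Hl. apply cderiv_eps. intros eps Heps.
  assert (Hm := proj1 (Cmod_gt_0 l) Hl).
  set (m := Cmod l) in *.
  set (e := Rmin (m / 2) (eps * m * m / 2)).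
  assert (He : 0 < e).
  { apply Rmin_glb_lt; [lra|]. assert (0 < eps * m) by nra. nra. }
  assert (He1 : e <= m / 2) by apply Rmin_l.
  assert (He2 : e <= eps * m * m / 2) by apply Rmin_r.
  destruct (proj1 (cderiv_eps _ _ _) Hf e He) as [d1 [Hd1 H1]].
  destruct (Hg d1 Hd1) as [d2 [Hd2 H2]].
  exists (Rmin r d2). split. { apply Rmin_glb_lt; auto. }
  intros u Hu.
  assert (Hu1 := Rlt_le_trans _ _ _ Hu (Rmin_l _ _)).
  assert (Hu2 := Rlt_le_trans _ _ _ Hu (Rmin_r _ _)).
  specialize (H1 (g u) (H2 u Hu2)).
  rewrite (Hfg u Hu1), (Hfg z) in H1.
  2: { replace (z - z)%C with (RtoC 0) by ring. rewrite Cmod_0. auto. }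
  set (D := (g u - g z)%C) in *. set (h := (u - z)%C) in *.
  assert (HD : m * Cmod D <= Cmod h + e * Cmod D).
  { unfold m. rewrite <- Cmod_mult. pose proof (Cmod_le_plus (l * D) h).
    rewrite Cmod_sub_sym in H. lra. }
  pose proof (Cmod_ge_0 D) as HD0. pose proof (Cmod_ge_0 h) as Hh0.
  assert (HD2 : m * Cmod D <= 2 * Cmod h) by nra.
  replace (D - / l * h)%C with (- ((h - l * D) / l))%C by (field; auto).
  rewrite Cmod_opp, Cmod_div by auto. fold m.
  apply Rle_div_l; auto. eapply Rle_trans. apply H1.
  assert (e * Cmod D <= eps * m * m / 2 * Cmod D) by (apply Rmult_le_compat_r; auto).
  assert (eps * m / 2 * (m * Cmod D) <= eps * m / 2 * (2 * Cmod h)).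
  { apply Rmult_le_compat_l; auto. nra. }
  nra.
Qed.

(** * Exponential and principal logarithm *)

Lemma Cexp_plus (a b : C) : Cexp (a + b) = (Cexp a * Cexp b)%C.
Proof.
  destruct a as [a1 a2], b as [b1 b2]. unfold Cexp, Cplus, Cmult; simpl.
  rewrite exp_plus, cos_plus, sin_plus. f_equal; ring.
Qed.

Lemma Cexp_0 : Cexp (RtoC 0) = RtoC 1.
Proof. unfold Cexp, RtoC; simpl. rewrite exp_0, cos_0, sin_0. f_equal; ring. Qed.

Lemma Cmod_Cexp (z : C) : Cmod (Cexp z) = exp (Re z).
Proof.
  unfold Cmod, Cexp; simpl.
  pose proof (sin2_cos2 (Im z)) as H. unfold Rsqr in H.
  pose proof (exp_pos (Re z)).
  match goal with |- sqrt ?x = _ => replace x with (exp (Re z) * exp (Re z)) by nra end.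
  apply sqrt_square. lra.
Qed.

Lemma Cexp_neq_0 (z : C) : Cexp z <> RtoC 0.
Proof. apply Cmod_gt_0. rewrite Cmod_Cexp. apply exp_pos. Qed.

Lemma Rderiv_eps (f : R -> R) (x l : R) :
  is_derive f x l ->
  (forall eps, 0 < eps -> exists d, 0 < d /\ forall u, Rabs (u - x) < d ->
     Rabs (f u - f x - l * (u - x)) <= eps * Rabs (u - x)).
Proof.
  intros [_ H] eps Heps.
  destruct (H x (fun P HP => HP) (mkposreal eps Heps)) as [d Hd].
  exists d; split; [apply cond_pos|].
  intros u Hu. specialize (Hd u Hu).
  replace (l * (u - x)) with ((u - x) * l) by ring.
  exact Hd.
Qed.

Lemma Cmod_le_abs (z : C) : Cmod z <= Rabs (Re z) + Rabs (Im z).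
Proof.
  replace z with (RtoC (Re z) + RtoC (Im z) * Ci)%C at 1.
  - eapply Rle_trans. apply Cmod_triangle.
    rewrite Cmod_mult, Cmod_Ci, !Cmod_R. lra.
  - destruct z. apply injective_projections; simpl; ring.
Qed.

Lemma im_le_Cmod (z : C) : Rabs (Im z) <= Cmod z.
Proof. eapply Rle_trans; [|apply Rmax_Cmod]. apply Rmax_r. Qed.

Lemma cderiv_Cexp_0 : cderiv Cexp (RtoC 0) (RtoC 1).
Proof.
  apply cderiv_eps. intros eps Heps.
  (* Each of the two components of the remainder will be at most [3 e |u|]. *)
  set (e := Rmin 1 (eps / 6)).
  assert (He : 0 < e) by (apply Rmin_glb_lt; lra).
  assert (He1 : e <= 1) by apply Rmin_l.
  assert (He2 : e <= eps / 6) by apply Rmin_r.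
  assert (De : is_derive exp 0 1) by (auto_derive; [auto|]; rewrite exp_0; ring).
  assert (Ds : is_derive sin 0 1) by (auto_derive; [auto|]; rewrite cos_0; ring).
  assert (Dc : is_derive cos 0 0) by (auto_derive; [auto|]; rewrite sin_0; ring).
  destruct (Rderiv_eps _ _ _ De e He) as [d1 [H1 D1]].
  destruct (Rderiv_eps _ _ _ Ds e He) as [d2 [H2 D2]].
  destruct (Rderiv_eps _ _ _ Dc e He) as [d3 [H3 D3]].
  rewrite exp_0 in D1. rewrite sin_0 in D2. rewrite cos_0 in D3.
  exists (Rmin (Rmin d1 d2) (Rmin d3 (e / 2))).
  split. { repeat apply Rmin_glb_lt; lra. }
  intros u Hu.
  assert (Hu1 := Rlt_le_trans _ _ _ Hu (Rmin_l _ _)).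
  assert (Hu2 := Rlt_le_trans _ _ _ Hu (Rmin_r _ _)).
  assert (Hu3 := Rlt_le_trans _ _ _ Hu1 (Rmin_l _ _)).
  assert (Hu4 := Rlt_le_trans _ _ _ Hu1 (Rmin_r _ _)).
  assert (Hu5 := Rlt_le_trans _ _ _ Hu2 (Rmin_l _ _)).
  assert (Hu6 := Rlt_le_trans _ _ _ Hu2 (Rmin_r _ _)).
  rewrite Cexp_0. replace (u - RtoC 0)%C with u in * by ring.
  pose proof (re_le_Cmod u) as Bx. pose proof (im_le_Cmod u) as By.
  destruct u as [x y]. simpl in Bx, By.
  set (r := Cmod (x, y)) in *.
  specialize (D1 x). specialize (D2 y). specialize (D3 y).
  rewrite Rminus_0_r in D1, D2, D3.
  specialize (D1 ltac:(lra)). specialize (D2 ltac:(lra)). specialize (D3 ltac:(lra)).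
  assert (E1 : Rabs (exp x - 1 - 1 * x) <= e * r) by nra.
  assert (E2 : Rabs (sin y - 0 - 1 * y) <= e * r) by nra.
  assert (E3 : Rabs (cos y - 1 - 0 * y) <= e * r) by nra.
  apply Rabs_le_between in E1, E2, E3, Bx, By.
  eapply Rle_trans. apply Cmod_le_abs. simpl.
  assert (X : - e <= exp x - 1 <= e) by nra.
  assert (Rabs (exp x * cos y + - (1) + - (1 * x - 0 * y)) <= 3 * (e * r)).
  { replace (exp x * cos y + - (1) + - (1 * x - 0 * y))
      with ((exp x - 1 - 1 * x) + exp x * (cos y - 1 - 0 * y)) by ring.
    apply Rabs_le_between. split; nra. }
  assert (Rabs (exp x * sin y + - 0 + - (1 * y + 0 * x)) <= 3 * (e * r)).
  { replace (exp x * sin y + - 0 + - (1 * y + 0 * x))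
      with (exp x * (sin y - 0 - 1 * y) + y * (exp x - 1)) by ring.
    apply Rabs_le_between. split; nra. }
  assert (0 <= r) by apply Cmod_ge_0.
  nra.
Qed.

Lemma cderiv_Cexp (z : C) : cderiv Cexp z (Cexp z).
Proof.
  eapply cderiv_ext_loc with (d := 1) (f := fun u => (Cexp z * Cexp (u - z))%C); [lra| |].
  { intros u _. rewrite <- Cexp_plus. f_equal. ring. }
  eapply cderiv_eq.
  - apply (cderiv_mult (fun _ => Cexp z) (fun u => Cexp (u - z))).
    apply cderiv_const.
    apply (cderiv_comp Cexp (fun u => u - z)%C).
    + replace (z - z)%C with (RtoC 0) by ring. apply cderiv_Cexp_0.
    + apply (cderiv_minus (fun u => u) (fun _ => z)). apply cderiv_id. apply cderiv_const.
  - simpl. ring.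
Qed.

(** The plane cut along the real half-line from minus infinity to 0, where the principal logarithm
    is holomorphic. *)
Definition slit (z : C) : Prop := 0 < Re z \/ Im z <> 0.

Lemma slit_neq_0 (z : C) : slit z -> z <> RtoC 0.
Proof. intros [H|H] ->; simpl in H; lra. Qed.

Lemma Re_div_Cmod_bound (z : C) : z <> RtoC 0 -> -1 <= Re z / Cmod z <= 1.
Proof.
  intros Hz. apply Cmod_gt_0 in Hz.
  pose proof (re_le_Cmod z) as H. apply Rabs_le_between in H.
  split; [apply Rle_div_r|apply Rle_div_l]; lra.
Qed.

Lemma cos_Carg (z : C) : z <> RtoC 0 -> Cmod z * cos (Carg z) = Re z.
Proof.
  intros Hz. pose proof (Re_div_Cmod_bound z Hz). apply Cmod_gt_0 in Hz.
  unfold Carg. destruct Rle_dec; [|rewrite cos_neg]; rewrite cos_acos by auto; field; lra.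
Qed.

Lemma sin_Carg (z : C) : z <> RtoC 0 -> Cmod z * sin (Carg z) = Im z.
Proof.
  intros Hz. pose proof (Re_div_Cmod_bound z Hz). apply Cmod_gt_0 in Hz.
  pose proof (Cmod2_alt z) as H2.
  assert (E : Cmod z * sqrt (1 - Rsqr (Re z / Cmod z)) = Rabs (Im z)).
  { rewrite <- sqrt_Rsqr_abs. rewrite <- (sqrt_Rsqr (Cmod z)) at 1 by lra.
    rewrite <- sqrt_mult_alt by apply Rle_0_sqr. f_equal. unfold Rsqr.
    replace (Im z * Im z) with (Cmod z ^ 2 - Re z * Re z) by lra. field. lra. }
  unfold Carg. destruct Rle_dec; [|rewrite sin_neg]; rewrite sin_acos by auto.
  - rewrite E. apply Rabs_pos_eq; auto.
  - rewrite Ropp_mult_distr_r_reverse, E. rewrite Rabs_left; lra.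
Qed.

Lemma Carg_bound (z : C) : z <> RtoC 0 -> - PI < Carg z <= PI.
Proof.
  intros Hz. unfold Carg. pose proof (acos_bound (Re z / Cmod z)).
  pose proof PI_RGT_0. destruct Rle_dec; [lra|].
  split; [|lra].
  (* The angle [- PI] would need [Re z = - |z|], hence [Im z = 0], against the branch [Im z < 0]. *)
  destruct (Req_dec (acos (Re z / Cmod z)) PI) as [E|]; [|lra].
  exfalso. pose proof (cos_acos _ (Re_div_Cmod_bound z Hz)) as E2.
  rewrite E, cos_PI in E2. apply Cmod_gt_0 in Hz.
  assert (Re z = - Cmod z). { apply (Rmult_eq_compat_r (Cmod z)) in E2. field_simplify in E2; lra. }
  pose proof (Cmod2_alt z). rewrite H1 in H2.
  assert (0 < Im z ^ 2) by (apply pow2_gt_0; lra). nra.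
Qed.

(** The hypotheses give [cos (a - b) = 1], so [sin ((a - b) / 2) = 0], while [|a - b| / 2 < PI]. *)
Lemma angle_unique (a b : R) :
  - PI < a <= PI -> - PI < b <= PI -> cos a = cos b -> sin a = sin b -> a = b.
Proof.
  intros Ha Hb Hc Hs.
  assert (Sg : sin ((a - b) / 2) = 0).
  { assert (C1 : cos (a - b) = 1).
    { rewrite cos_minus, Hc, Hs. pose proof (sin2_cos2 b). unfold Rsqr in H. lra. }
    replace (a - b) with (2 * ((a - b) / 2)) in C1 by field.
    rewrite cos_2a_sin in C1. nra. }
  destruct (Req_dec a b) as [|N]; auto. exfalso.
  destruct (Rtotal_order a b) as [L|[L|L]]; [|lra|].
  - pose proof (sin_gt_0 ((b - a) / 2) ltac:(lra) ltac:(lra)).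
    replace ((a - b) / 2) with (- ((b - a) / 2)) in Sg by field. rewrite sin_neg in Sg. lra.
  - pose proof (sin_gt_0 ((a - b) / 2) ltac:(lra) ltac:(lra)). lra.
Qed.

Lemma Cexp_Cln (z : C) : z <> RtoC 0 -> Cexp (Cln z) = z.
Proof.
  intros Hz. unfold Cexp, Cln; simpl. rewrite exp_ln by (apply Cmod_gt_0; auto).
  rewrite cos_Carg, sin_Carg by auto. destruct z; reflexivity.
Qed.

Lemma Cln_Cexp (z : C) : - PI < Im z <= PI -> Cln (Cexp z) = z.
Proof.
  intros H. unfold Cln. rewrite Cmod_Cexp, ln_exp.
  assert (N := Cexp_neq_0 z).
  replace (Carg (Cexp z)) with (Im z). destruct z; reflexivity.
  pose proof (cos_Carg _ N) as H1. pose proof (sin_Carg _ N) as H2.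
  rewrite Cmod_Cexp in H1, H2. simpl in H1, H2. pose proof (exp_pos (Re z)).
  apply angle_unique; auto. apply Carg_bound; auto.
  - apply Rmult_eq_reg_l with (exp (Re z)); lra.
  - apply Rmult_eq_reg_l with (exp (Re z)); lra.
Qed.

Lemma Cln_1 : Cln (RtoC 1) = RtoC 0.
Proof.
  rewrite <- Cexp_0. apply Cln_Cexp. simpl. pose proof PI_RGT_0. lra.
Qed.

(** In this form the continuity of the argument on the right half-plane is that of a composite. *)
Lemma Carg_right (z : C) : 0 < Re z -> Carg z = atan (Im z / Re z).
Proof.
  intros Hx.
  assert (N : z <> RtoC 0) by (apply slit_neq_0; left; auto).
  set (r := sqrt (1 + Rsqr (Im z / Re z))).
  assert (Hr : r * Re z = Cmod z).
  { unfold r, Cmod. rewrite <- (sqrt_Rsqr (Re z)) at 2 by lra.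
    rewrite <- sqrt_mult_alt. f_equal. unfold Rsqr, Re, Im; simpl. field.
    unfold Re in Hx; lra. unfold Rsqr. nra. }
  assert (Hm := proj1 (Cmod_gt_0 z) N).
  pose proof (cos_Carg z N) as H1. pose proof (sin_Carg z N) as H2.
  pose proof (atan_bound (Im z / Re z)). pose proof PI_RGT_0.
  assert (r <> 0) by (intros E; rewrite E in Hr; lra).
  apply angle_unique; [apply Carg_bound; auto|lra| |].
  - rewrite cos_atan. fold r. apply Rmult_eq_reg_l with (Cmod z); [|lra].
    rewrite H1, <- Hr. field. auto.
  - rewrite sin_atan. fold r. apply Rmult_eq_reg_l with (Cmod z); [|lra].
    rewrite H2, <- Hr. field. split; auto. lra.
Qed.

Lemma ccont_components (f : C -> C) (z : C) :
  continuous (T := C_UniformSpace) (U := R_UniformSpace) (fun u => Re (f u)) z ->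
  continuous (T := C_UniformSpace) (U := R_UniformSpace) (fun u => Im (f u)) z ->
  ccont f z.
Proof.
  intros H1 H2 eps Heps.
  assert (He : 0 < eps / 2) by lra.
  destruct (H1 _ (locally_ball (Re (f z)) (mkposreal _ He))) as [d1 D1].
  destruct (H2 _ (locally_ball (Im (f z)) (mkposreal _ He))) as [d2 D2].
  exists (Rmin d1 d2). split. { apply Rmin_glb_lt; apply cond_pos. }
  intros u Hu.
  assert (Hu1 := Rlt_le_trans _ _ _ Hu (Rmin_l _ _)).
  assert (Hu2 := Rlt_le_trans _ _ _ Hu (Rmin_r _ _)).
  specialize (D1 u (C_NormedModule_mixin_compat1 z u d1 Hu1)).
  specialize (D2 u (C_NormedModule_mixin_compat1 z u d2 Hu2)).
  eapply Rle_lt_trans. apply Cmod_le_abs.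
  replace eps with (eps / 2 + eps / 2) by field.
  apply Rplus_lt_compat; [exact D1|exact D2].
Qed.

Lemma continuous_Re (z : C) :
  continuous (T := C_UniformSpace) (U := R_UniformSpace) Re z.
Proof. apply (continuous_fst (U := R_UniformSpace) (V := R_UniformSpace)). Qed.

Lemma continuous_Im (z : C) :
  continuous (T := C_UniformSpace) (U := R_UniformSpace) Im z.
Proof. apply (continuous_snd (U := R_UniformSpace) (V := R_UniformSpace)). Qed.

(** [Cln] is a right inverse of [Cexp], so [cderiv_inverse] applies once [Cln] is continuous;
    continuity is read off from the formula [(ln (x^2 + y^2) / 2, atan (y / x))], valid for
    [x > 0]. *)
Lemma cderiv_Cln_right (z : C) : 0 < Re z -> cderiv Cln z (/ z)%C.
Proof.
  intros Hx. assert (N : z <> RtoC 0) by (apply slit_neq_0; left; auto).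
  assert (Near : forall u, Cmod (u - z) < Re z -> 0 < Re u).
  { intros u Hu. pose proof (re_le_Cmod (u - z)) as H. simpl in H.
    apply Rabs_le_between in H. unfold Re in *. lra. }
  apply (cderiv_inverse Cexp Cln z z (Re z)); auto.
  - intros u Hu. apply Cexp_Cln. apply slit_neq_0. left. auto.
  - set (g := fun u : C => (/ 2 * ln (Re u * Re u + Im u * Im u), atan (Im u / Re u)) : C).
    assert (Hg : ccont g z).
    { apply ccont_components; unfold g; simpl.
      - apply (continuous_comp (U := C_UniformSpace) (V := R_UniformSpace) (W := R_UniformSpace)
          (fun u => Re u * Re u + Im u * Im u) (fun t => / 2 * ln t)).
        + apply (continuous_plus (K := R_AbsRing) (V := R_NormedModule) (U := C_UniformSpace)
            (fun u => Re u * Re u) (fun u => Im u * Im u));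
          apply (continuous_mult (K := R_AbsRing) (U := C_UniformSpace));
          first [apply continuous_Re|apply continuous_Im].
        + apply (ex_derive_continuous (K := R_AbsRing) (V := R_NormedModule)). auto_derive. nra.
      - apply (continuous_comp (U := C_UniformSpace) (V := R_UniformSpace) (W := R_UniformSpace)
          (fun u => Im u / Re u) atan).
        + apply (continuous_mult (K := R_AbsRing) (U := C_UniformSpace) Im (fun u => / Re u)).
          apply continuous_Im.
          apply (continuous_comp (U := C_UniformSpace) (V := R_UniformSpace) (W := R_UniformSpace)
            Re Rinv). apply continuous_Re.
          apply continuous_Rinv. lra.
        + apply (ex_derive_continuous (K := R_AbsRing) (V := R_NormedModule)). auto_derive. auto. }
    assert (Eg : forall u, 0 < Re u -> Cln u = g u).
    { intros u Hu. unfold Cln, g. f_equal; [|apply Carg_right; auto].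
      assert (0 < Cmod u) by (apply Cmod_gt_0, slit_neq_0; left; auto).
      replace (Re u * Re u + Im u * Im u) with (Cmod u * Cmod u).
      rewrite ln_mult by auto. field.
      pose proof (Cmod2_alt u). nra. }
    intros eps Heps. destruct (Hg eps Heps) as [d [Hd D]].
    exists (Rmin d (Re z)). split. { apply Rmin_glb_lt; auto. }
    intros u Hu.
    assert (Hu1 := Rlt_le_trans _ _ _ Hu (Rmin_l _ _)).
    assert (Hu2 := Rlt_le_trans _ _ _ Hu (Rmin_r _ _)).
    rewrite !Eg; auto.
  - eapply cderiv_eq. apply cderiv_Cexp. apply Cexp_Cln; auto.
Qed.

Lemma Cln_rotate (z c : C) (t : R) :
  z <> RtoC 0 -> c = Cexp (0, t) -> - PI < Carg z + t <= PI ->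
  Cln (z * c) = (Cln z + (0, t))%C.
Proof.
  intros Hz -> Ht. rewrite <- (Cexp_Cln z Hz) at 1. rewrite <- Cexp_plus.
  apply Cln_Cexp. simpl. auto.
Qed.

Lemma Carg_lt_half (z : C) : z <> RtoC 0 -> (Rabs (Carg z) < PI / 2 <-> 0 < Re z).
Proof.
  intros Hz. pose proof (cos_Carg z Hz) as H. apply Cmod_gt_0 in Hz.
  split; intros H'.
  - apply Rabs_lt_between in H'. rewrite <- H.
    apply Rmult_lt_0_compat; auto. apply cos_gt_0; lra.
  - rewrite Carg_right by auto. apply Rabs_lt_between. pose proof (atan_bound (Im z / Re z)). lra.
Qed.

Lemma cderiv_Cln (z : C) : slit z -> cderiv Cln z (/ z)%C.
Proof.
  intros Hs. destruct (Rlt_dec 0 (Re z)) as [Hx|Hx]; [apply cderiv_Cln_right; auto|].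
  assert (Hy : Im z <> 0) by (destruct Hs; [contradiction|auto]). clear Hs.
  assert (N : z <> RtoC 0) by (apply slit_neq_0; right; auto).
  (* [s] is the sign of [Im z]. The factor [c = - s i] rotates the half-plane containing [z] onto
     the right half-plane, and adding [k = s i PI / 2] to the logarithm undoes the rotation. *)
  set (s := if Rlt_dec 0 (Im z) then 1 else -1).
  assert (Hs : (s = 1 \/ s = -1) /\ 0 < s * Im z).
  { unfold s; destruct Rlt_dec; lra. }
  destruct Hs as [Hs Hp]. assert (s * s = 1) by (destruct Hs as [-> | ->]; ring).
  pose (c := (0, - s) : C). pose (k := (0, s * (PI / 2)) : C).
  assert (Ec : forall u : C, Re (u * c) = s * Im u) by (intros [a b]; unfold c; simpl; ring).
  assert (c0 : Cmult (0, s) c = RtoC 1).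
  { apply injective_projections; simpl; lra. }
  assert (Near : forall u, Cmod (u - z) < s * Im z -> 0 < Re (u * c)).
  { intros u Hu. rewrite Ec. pose proof (im_le_Cmod (u - z)) as H'. simpl in H'.
    apply Rabs_le_between in H'. unfold Im in *. destruct Hs as [-> | ->]; lra. }
  apply cderiv_ext_loc with (d := s * Im z)
    (f := fun u => (Cln (u * c) + k)%C); auto.
  - intros u Hu. specialize (Near u Hu).
    assert (Nu := slit_neq_0 _ (or_introl Near)).
    unfold k. transitivity (Cln ((u * c) * (0, s))%C); [symmetry; apply Cln_rotate; auto|].
    3: { f_equal. rewrite <- Cmult_assoc, (Cmult_comm c), c0. ring. }
    + unfold Cexp, k; simpl. rewrite exp_0.
      destruct Hs as [-> | ->].
      rewrite !Rmult_1_l, cos_PI2, sin_PI2. f_equal; ring.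
      replace (-1 * (PI / 2)) with (- (PI / 2)) by ring.
      rewrite cos_neg, sin_neg, cos_PI2, sin_PI2. f_equal; ring.
    + apply Carg_lt_half in Near; auto. apply Rabs_lt_between in Near.
      pose proof PI_RGT_0. destruct Hs as [-> | ->]; lra.
  - eapply cderiv_eq.
    + apply (cderiv_plus (fun u => Cln (u * c)%C) (fun _ => k)).
      * apply (cderiv_comp Cln (fun u => u * c)%C).
        apply cderiv_Cln_right. rewrite Ec. auto.
        apply (cderiv_mult (fun u => u) (fun _ => c)).
        apply cderiv_id. apply cderiv_const.
      * apply cderiv_const.
    + assert (c <> RtoC 0 :> C).
      { intros E. apply (f_equal snd) in E. simpl in E. lra. }
      simpl. field. auto.
Qed.

(** * Maxima of continuous functions *)

(** Compactness of the square [[-M, M]^2] in the manner of a Lebesgue number: each point of the disc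
    lies in a gauge ball whose radius is bounded below. *)
Lemma compact_gauge (M : R) (P : C -> R -> Prop) :
  (forall z, exists d, 0 < d /\ P z d) ->
  exists d0, 0 < d0 /\ forall u, Cmod u <= M ->
    exists z d, P z d /\ Cmod (u - z) < d /\ d0 <= d.
Proof.
  intros H.
  set (e := fun z => constructive_indefinite_description _ (H z)).
  set (delta := fun z => proj1_sig (e z)).
  assert (Hd : forall z, 0 < delta z) by (intros z; apply (proj2_sig (e z))).
  assert (HP : forall z, P z (delta z)) by (intros z; apply (proj2_sig (e z))).
  (* Halved because compactness controls each coordinate, and [Cmod] is at most the sum of the
     two. *)
  assert (Hd2 : forall z, 0 < delta z / 2) by (intros z; specialize (Hd z); lra).
  destruct (compactness_value_2d (- M) M (- M) M
    (fun x y => mkposreal _ (Hd2 (x, y)))) as [d0 D].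
  exists d0; split; [apply cond_pos|]. intros u Hu.
  pose proof (re_le_Cmod u) as Bx. pose proof (im_le_Cmod u) as By.
  apply Rabs_le_between in Bx, By.
  destruct (NNPP _ (D (Re u) (Im u) ltac:(lra) ltac:(lra)))
    as [a [b [_ [_ [Ha [Hb Hab]]]]]].
  simpl in Ha, Hb, Hab.
  exists (a, b), (delta (a, b)). repeat split; auto.
  - eapply Rle_lt_trans. apply Cmod_le_abs. simpl. unfold Re, Im in *.
    unfold Rminus in *. lra.
  - specialize (Hd (a, b)). lra.
Qed.

(** The third hypothesis is upper semicontinuity. By compactness [f] is bounded on [S] by values
    [f z + k (f z)] with [k (f z)] bounded away from 0; two choices of [k] give first a supremum,
    then its attainment. *)
Lemma compact_max (S : C -> Prop) (f : C -> R) (M : R) :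
  (forall z, S z -> Cmod z <= M) ->
  (forall z, ~ S z -> exists d, 0 < d /\ forall u, Cmod (u - z) < d -> ~ S u) ->
  (forall z, S z -> forall eps, 0 < eps ->
     exists d, 0 < d /\ forall u, Cmod (u - z) < d -> f u < f z + eps) ->
  (exists z, S z) ->
  exists z, S z /\ forall u, S u -> f u <= f z.
Proof.
  intros HM Hcl Hc [z0 Hz0].
  (* Boundedness takes [k y = 1 / (1 + |y|)], attainment [k y = (sup f - y) / 2]. *)
  assert (Key : forall k : R -> R, (forall z, S z -> 0 < k (f z)) ->
    exists d0, 0 < d0 /\ forall u, S u ->
      exists z, S z /\ f u < f z + k (f z) /\ d0 <= k (f z)).
  { intros k Hk.
    destruct (compact_gauge M (fun z d => (S z -> d <= k (f z) /\
       forall u, Cmod (u - z) < d -> f u < f z + k (f z)) /\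
       (~ S z -> forall u, Cmod (u - z) < d -> ~ S u))) as [d0 [Hd0 D]].
    - intros z. destruct (classic (S z)) as [Hz|Hz].
      + specialize (Hk z Hz). destruct (Hc z Hz (k (f z)) Hk) as [d [Hd D]].
        exists (Rmin d (k (f z))). split; [apply Rmin_glb_lt; auto|].
        split; [|contradiction]. intros _. split; [apply Rmin_r|].
        intros u Hu. apply D. eapply Rlt_le_trans; [apply Hu|apply Rmin_l].
      + destruct (Hcl z Hz) as [d [Hd D]]. exists d. split; auto.
        split; [contradiction|]. auto.
    - exists d0. split; auto. intros u Hu.
      destruct (D u (HM u Hu)) as [z [d [[H1 H2] [H3 H4]]]].
      destruct (classic (S z)) as [Hz|Hz].
      + destruct (H1 Hz) as [H5 H6]. exists z. repeat split; auto. lra.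
      + exfalso. exact (H2 Hz u H3 Hu). }
  set (E := fun y => exists z, S z /\ y = f z).
  assert (HE : bound E).
  { destruct (Key (fun y => / (1 + Rabs y))) as [d0 [Hd0 D]].
    - intros z _. apply Rinv_0_lt_compat. pose proof (Rabs_pos (f z)). lra.
    - exists (/ d0). intros y [u [Hu ->]]. destruct (D u Hu) as [z [Hz [H1 H2]]].
      pose proof (Rabs_pos (f z)). pose proof (Rle_abs (f z)).
      assert (/ (1 + Rabs (f z)) <= 1).
      { rewrite <- Rinv_1. apply Rinv_le_contravar; lra. }
      apply Rinv_le_contravar in H2; auto. rewrite Rinv_inv in H2. lra. }
  destruct (completeness E HE) as [s [Hs1 Hs2]].
  { exists (f z0), z0; auto. }
  destruct (classic (exists z, S z /\ f z = s)) as [[z [Hz <-]]|Hn].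
  { exists z. split; auto. intros u Hu. apply Hs1. exists u; auto. }
  exfalso.
  assert (Hlt : forall z, S z -> f z < s).
  { intros z Hz. destruct (Hs1 (f z)) as [L|L]; auto. exists z; auto.
    exfalso. apply Hn. exists z; auto. }
  destruct (Key (fun y => (s - y) / 2)) as [d0 [Hd0 D]].
  { intros z Hz. specialize (Hlt z Hz). lra. }
  (* [f u < (s + f z) / 2 <= s - d0], so [s - d0] would be an upper bound below the supremum. *)
  assert (s <= s - d0); [|lra].
  apply Hs2. intros y [u [Hu ->]]. destruct (D u Hu) as [z [Hz [H1 H2]]]. lra.
Qed.

(** * Derivatives along real lines and the second-derivative test *)

Lemma Rderiv_of_eps (f : R -> R) (x l : R) :
  (forall eps, 0 < eps -> exists d, 0 < d /\ forall u, Rabs (u - x) < d ->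
     Rabs (f u - f x - l * (u - x)) <= eps * Rabs (u - x)) ->
  is_derive f x l.
Proof.
  intros H. split. apply is_linear_scal_l.
  intros y Hy eps.
  assert (x = y) by exact (is_filter_lim_locally_unique x y Hy). subst y.
  destruct (H eps (cond_pos eps)) as [d [Hd0 Hd]].
  exists (mkposreal d Hd0). intros u Hu. specialize (Hd u Hu).
  replace (l * (u - x)) with ((u - x) * l) in Hd by ring.
  exact Hd.
Qed.

Lemma cderiv_line (f : C -> C) (z v l : C) (t : R) :
  cderiv f (z + RtoC t * v)%C l ->
  is_derive (fun s : R => Re (f (z + RtoC s * v)%C)) t (Re (l * v)%C) /\
  is_derive (fun s : R => Im (f (z + RtoC s * v)%C)) t (Im (l * v)%C).
Proof.
  intros H. rewrite cderiv_eps in H.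
  assert (Hv := Cmod_ge_0 v).
  assert (Key : forall eps, 0 < eps -> exists d, 0 < d /\ forall u : R, Rabs (u - t) < d ->
    Cmod (f (z + RtoC u * v) - f (z + RtoC t * v) - (l * v) * RtoC (u - t))%C
      <= eps * Rabs (u - t)).
  { intros eps Heps.
    assert (He : 0 < eps / (1 + Cmod v)) by (apply Rdiv_lt_0_compat; lra).
    destruct (H _ He) as [d [Hd D]].
    exists (d / (1 + Cmod v)). split. { apply Rdiv_lt_0_compat; lra. }
    intros u Hu. apply Rlt_div_r in Hu; [|lra].
    assert (Es : (z + RtoC u * v - (z + RtoC t * v))%C = (RtoC (u - t) * v)%C).
    { rewrite RtoC_minus. ring. }
    pose proof (Rabs_pos (u - t)).
    specialize (D (z + RtoC u * v)%C). rewrite Es in D.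
    rewrite !Cmod_mult, Cmod_R in D.
    replace (l * v * RtoC (u - t))%C with (l * (RtoC (u - t) * v))%C by ring.
    eapply Rle_trans. apply D; nra.
    replace (eps * Rabs (u - t)) with (eps / (1 + Cmod v) * (Rabs (u - t) * (1 + Cmod v)))
      by (field; lra).
    apply Rmult_le_compat_l; nra. }
  split; apply Rderiv_of_eps; intros eps Heps;
  destruct (Key eps Heps) as [d [Hd D]]; exists d; (split; [exact Hd|]);
  intros u Hu; (eapply Rle_trans; [|apply (D u Hu)]).
  - eapply Rle_trans; [|apply re_le_Cmod]. right. f_equal. unfold Re, Im; simpl. ring.
  - eapply Rle_trans; [|apply im_le_Cmod]. right. f_equal. unfold Re, Im; simpl. ring.
Qed.

Lemma right_max_deriv (g : R -> R) (c d : R) :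
  0 < d -> is_derive g 0 c -> (forall t, 0 < t < d -> g t <= g 0) -> c <= 0.
Proof.
  intros Hd H Hm. apply Rnot_lt_le. intros Hc.
  destruct (Rderiv_eps _ _ _ H (c / 2) ltac:(lra)) as [e [He D]].
  pose proof (Rmin_l d e). pose proof (Rmin_r d e).
  assert (0 < Rmin d e) by (apply Rmin_glb_lt; auto).
  set (t := Rmin d e / 2) in *.
  assert (Ht : 0 < t < d /\ t < e) by (unfold t; lra).
  specialize (D t). rewrite Rminus_0_r, Rabs_pos_eq in D by lra.
  specialize (D ltac:(lra)). apply Rabs_le_between in D.
  specialize (Hm t ltac:(lra)). nra.
Qed.

(** [right_max_deriv] for [g t] and for [g (- t)] gives [g' 0 = 0]. Were [c > 0], [g'] would be
    positive just to the right of 0, and by the mean value theorem [g] would exceed [g 0] there. *)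
Lemma local_max_second (g g' : R -> R) (c d : R) :
  0 < d -> (forall t, Rabs t < d -> is_derive g t (g' t)) -> is_derive g' 0 c ->
  (forall t, Rabs t < d -> g t <= g 0) -> c <= 0.
Proof.
  intros Hd Hg Hg' Hm.
  assert (D0 : is_derive g 0 (g' 0)) by (apply Hg; rewrite Rabs_R0; auto).
  assert (A1 : g' 0 <= 0).
  { apply right_max_deriv with g d; auto. intros t Ht. apply Hm. rewrite Rabs_pos_eq; lra. }
  assert (A2 : - g' 0 <= 0).
  { apply right_max_deriv with (fun t => g (- t)) d; auto.
    - replace (- g' 0) with (-1 * g' 0) by ring.
      apply (is_derive_comp g (fun t => - t)).
      rewrite Ropp_0. exact D0. auto_derive; auto.
    - intros t Ht. rewrite Ropp_0. apply Hm. rewrite Rabs_Ropp, Rabs_pos_eq; lra. }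
  assert (E0 : g' 0 = 0) by lra.
  apply Rnot_lt_le. intros Hc.
  destruct (Rderiv_eps _ _ _ Hg' (c / 2) ltac:(lra)) as [e [He D]].
  pose proof (Rmin_l d e). pose proof (Rmin_r d e).
  assert (0 < Rmin d e) by (apply Rmin_glb_lt; auto).
  set (t := Rmin d e / 2) in *.
  assert (Ht : 0 < t < d /\ t < e) by (unfold t; lra).
  destruct (MVT_cor2 g g' 0 t) as [s [Hs1 Hs2]]; [lra| |].
  { intros s Hs. apply is_derive_Reals. apply Hg. rewrite Rabs_pos_eq; lra. }
  specialize (D s). rewrite Rminus_0_r, Rabs_pos_eq in D by lra.
  specialize (D ltac:(lra)). apply Rabs_le_between in D.
  specialize (Hm t). rewrite Rabs_pos_eq in Hm by lra. specialize (Hm ltac:(lra)).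
  assert (0 < c * s) by (apply Rmult_lt_0_compat; lra).
  assert (0 < g' s * (t - 0)) by (apply Rmult_lt_0_compat; lra).
  lra.
Qed.

(** Polynomial in the coordinates, so that it can be differentiated along lines without a square
    root. *)
Definition sqmod (z : C) : R := Re z * Re z + Im z * Im z.

Lemma sqmod_Cmod (z : C) : sqmod z = Cmod z ^ 2.
Proof. rewrite Cmod2_alt. unfold sqmod. ring. Qed.

(** The left side of the conclusion is the second derivative at [t = 0] of
    [|F|^2 + eps (ln |u| + |u|^2)] along [u = z + t v]. *)
Lemma local_max_line (F F1 : C -> C) (F2 z v : C) (eps d : R) :
  z <> RtoC 0 -> 0 < d ->
  (forall u, Cmod (u - z) < d -> cderiv F u (F1 u)) -> cderiv F1 z F2 ->
  (forall u, Cmod (u - z) < d ->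
     sqmod (F u) + eps * (/ 2 * ln (sqmod u) + sqmod u)
     <= sqmod (F z) + eps * (/ 2 * ln (sqmod z) + sqmod z)) ->
  2 * sqmod (F1 z * v)%C
    + 2 * (Re (F z) * Re (F2 * v * v)%C + Im (F z) * Im (F2 * v * v)%C)
    + eps * (sqmod v / sqmod z
       - 2 * (Re z * Re v + Im z * Im v) ^ 2 / sqmod z ^ 2
       + 2 * sqmod v) <= 0.
Proof.
  intros Hz Hd HF HF1 Hmax.
  pose (A := fun t : R => Re (F (z + RtoC t * v)%C)).
  pose (B := fun t : R => Im (F (z + RtoC t * v)%C)).
  pose (A1 := fun t : R => Re (F1 (z + RtoC t * v) * v)%C).
  pose (B1 := fun t : R => Im (F1 (z + RtoC t * v) * v)%C).
  pose (N := fun t : R => (Re z + t * Re v) * (Re z + t * Re v)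
                          + (Im z + t * Im v) * (Im z + t * Im v)).
  pose (N1 := fun t : R => 2 * ((Re z + t * Re v) * Re v + (Im z + t * Im v) * Im v)).
  assert (EN : forall t, sqmod (z + RtoC t * v)%C = N t).
  { intros t. unfold N, sqmod, Re, Im; simpl. ring. }
  assert (E0 : (z + RtoC 0 * v)%C = z) by ring.
  assert (N0 : N 0 = sqmod z) by (rewrite <- EN, E0; auto).
  assert (Np : 0 < sqmod z).
  { rewrite sqmod_Cmod. apply pow_lt. apply Cmod_gt_0; auto. }
  pose proof (Cmod_ge_0 v) as Hv.
  pose proof (proj1 (Cmod_gt_0 z) Hz) as Hz'.
  (* For [|t| < e] the point [z + t v] stays within [d] of [z] and away from the origin. *)
  set (e := Rmin d (Cmod z) / (1 + Cmod v)).
  assert (He : 0 < e).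
  { apply Rdiv_lt_0_compat; [apply Rmin_glb_lt; auto|lra]. }
  assert (Near : forall t, Rabs t < e -> Cmod (z + RtoC t * v - z) < Rmin d (Cmod z)).
  { intros t Ht. replace (z + RtoC t * v - z)%C with (RtoC t * v)%C by ring.
    rewrite Cmod_mult, Cmod_R. apply Rlt_div_r in Ht; [|lra].
    pose proof (Rabs_pos t). nra. }
  assert (DA : forall t, Rabs t < e -> is_derive A t (A1 t) /\ is_derive B t (B1 t)).
  { intros t Ht. apply cderiv_line. apply HF.
    eapply Rlt_le_trans; [apply Near; auto|apply Rmin_l]. }
  assert (DA1 : is_derive A1 0 (Re (F2 * v * v)%C) /\ is_derive B1 0 (Im (F2 * v * v)%C)).
  { apply (cderiv_line (fun u => F1 u * v)%C). rewrite E0.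
    eapply cderiv_eq. apply (cderiv_mult F1 (fun _ => v)). apply HF1. apply cderiv_const.
    ring. }
  assert (NP : forall t, Rabs t < e -> 0 < N t).
  { intros t Ht. rewrite <- EN, sqmod_Cmod. apply pow_lt.
    assert (H := Rlt_le_trans _ _ _ (Near t Ht) (Rmin_r _ _)).
    pose proof (Cmod_le_plus z (z + RtoC t * v)). rewrite Cmod_sub_sym in H0. lra. }
  assert (DN : forall t, is_derive N t (N1 t)).
  { intros t. unfold N, N1. auto_derive; auto. ring. }
  set (g := fun t => A t * A t + B t * B t + eps * (/ 2 * ln (N t) + N t)).
  set (g' := fun t => 2 * (A t * A1 t + B t * B1 t) + eps * (/ 2 * (N1 t / N t) + N1 t)).
  apply (local_max_second g g' _ e He).
  - intros t Ht. destruct (DA t Ht) as [a b]. specialize (NP t Ht). specialize (DN t).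
    unfold g, g'. auto_derive.
    + repeat split; auto; eexists; eauto.
    + rewrite (is_derive_unique (fun x : R => A x) _ _ a), (is_derive_unique (fun x : R => B x) _ _ b),
        (is_derive_unique (fun x : R => N x) _ _ DN). field. lra.
  - assert (H0 : Rabs 0 < e) by (rewrite Rabs_R0; auto).
    destruct (DA 0 H0) as [a b]. specialize (NP 0 H0). destruct DA1 as [a1 b1].
    assert (DN1 : is_derive N1 0 (2 * sqmod v)).
    { unfold N1, sqmod. auto_derive; auto. ring. }
    specialize (DN 0).
    unfold g'. auto_derive.
    + repeat split; auto; try (eexists; eauto); lra.
    + rewrite (is_derive_unique (fun x : R => A x) _ _ a), (is_derive_unique (fun x : R => B x) _ _ b),
        (is_derive_unique (fun x : R => A1 x) _ _ a1), (is_derive_unique (fun x : R => B1 x) _ _ b1),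
        (is_derive_unique (fun x : R => N x) _ _ DN), (is_derive_unique (fun x : R => N1 x) _ _ DN1).
      unfold A, B, A1, B1. rewrite E0.
      assert (EN1 : N1 0 = 2 * (Re z * Re v + Im z * Im v)) by (unfold N1; ring).
      rewrite EN1, N0. change (sqmod (F1 z * v)%C) with
        (Re (F1 z * v)%C * Re (F1 z * v)%C + Im (F1 z * v)%C * Im (F1 z * v)%C).
      field. lra.
  - intros t Ht. unfold g, A, B. rewrite E0, N0, <- EN.
    apply (Hmax (z + RtoC t * v)%C).
    eapply Rlt_le_trans; [apply Near; auto|apply Rmin_l].
Qed.

(* The term [ln |u|] is harmonic and [|u|^2] strictly subharmonic. *)
Lemma no_local_max (F F1 : C -> C) (F2 z : C) (eps d : R) :
  z <> RtoC 0 -> 0 < eps -> 0 < d ->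
  (forall u, Cmod (u - z) < d -> cderiv F u (F1 u)) -> cderiv F1 z F2 ->
  (forall u, Cmod (u - z) < d ->
     sqmod (F u) + eps * (/ 2 * ln (sqmod u) + sqmod u)
     <= sqmod (F z) + eps * (/ 2 * ln (sqmod z) + sqmod z)) -> False.
Proof.
  intros Hz He Hd HF HF1 Hm.
  (* The directions [1] and [i] are added to form a Laplacian: the [F2] terms cancel since
     [i^2 = -1], and [4 |F1 z|^2 + 4 eps <= 0] remains. *)
  pose proof (local_max_line F F1 F2 z (RtoC 1) eps d Hz Hd HF HF1 Hm) as X1.
  pose proof (local_max_line F F1 F2 z Ci eps d Hz Hd HF HF1 Hm) as X2.
  assert (Np : 0 < sqmod z).
  { rewrite sqmod_Cmod. apply pow_lt. apply Cmod_gt_0; auto. }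
  replace (F2 * RtoC 1 * RtoC 1)%C with F2 in X1 by ring.
  replace (F2 * Ci * Ci)%C with (- F2)%C in X2
    by (apply injective_projections; simpl; ring).
  rewrite sqmod_Cmod, Cmod_mult, Rpow_mult_distr, <- !sqmod_Cmod in X1, X2.
  replace (sqmod 1) with 1 in X1 by (unfold sqmod; simpl; ring).
  replace (sqmod Ci) with 1 in X2 by (unfold sqmod; simpl; ring).
  simpl in X1, X2.
  assert (0 <= sqmod (F1 z)) by (rewrite sqmod_Cmod; apply pow2_ge_0).
  assert (E : (1 / sqmod z - 2 * (Re z * 1 + Im z * 0) ^ 2 / sqmod z ^ 2 + 2 * 1)
    + (1 / sqmod z - 2 * (Re z * 0 + Im z * 1) ^ 2 / sqmod z ^ 2 + 2 * 1) = 4).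
  { transitivity (4 + 2 / sqmod z * (1 - (Re z * Re z + Im z * Im z) / sqmod z)).
    field; lra. fold (sqmod z). field. lra. }
  simpl in E. unfold Re, Im in *. simpl in *. nra.
Qed.

(** * The lemmas of Schwarz and Jack *)

Lemma ccont_continuous (f : C -> C) (z : C) :
  ccont f z ->
  continuous (T := C_UniformSpace) (U := R_UniformSpace) (fun u => Re (f u)) z /\
  continuous (T := C_UniformSpace) (U := R_UniformSpace) (fun u => Im (f u)) z.
Proof.
  intros H. assert (S2 := sqrt_lt_R0 2 ltac:(lra)).
  assert (Key : forall eps : posreal, exists d : posreal, forall u,
    ball (M := C_UniformSpace) z d u -> Cmod (f u - f z) < eps).
  { intros eps. destruct (H eps (cond_pos eps)) as [d [Hd D]].
    assert (Hd' : 0 < d / sqrt 2) by (apply Rdiv_lt_0_compat; auto).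
    exists (mkposreal _ Hd'). intros u Hu. apply D.
    pose proof (C_NormedModule_mixin_compat2 z u _ Hu) as X. simpl in X.
    replace (sqrt 2 * (d / sqrt 2)) with d in X by (field; lra). exact X. }
  split; intros P [e HP]; destruct (Key e) as [d D]; exists d; intros u Hu;
    apply HP; specialize (D u Hu); (eapply Rle_lt_trans; [|exact D]).
  - apply (re_le_Cmod (f u - f z)%C).
  - apply (im_le_Cmod (f u - f z)%C).
Qed.

Lemma sqmod_pos (z : C) : z <> RtoC 0 -> 0 < sqmod z.
Proof. intros Hz. rewrite sqmod_Cmod. apply pow_lt, Cmod_gt_0, Hz. Qed.

Lemma continuous_sqmod (f : C -> C) (z : C) :
  ccont f z ->
  continuous (T := C_UniformSpace) (U := R_UniformSpace) (fun u => sqmod (f u)) z.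
Proof.
  intros H. apply ccont_continuous in H. destruct H as [H1 H2].
  apply (continuous_plus (K := R_AbsRing) (V := R_NormedModule) (U := C_UniformSpace)
    (fun u => Re (f u) * Re (f u)) (fun u => Im (f u) * Im (f u)));
  apply (continuous_mult (K := R_AbsRing) (U := C_UniformSpace)); auto.
Qed.

Lemma half_ln_sqmod (z : C) : z <> RtoC 0 -> / 2 * ln (sqmod z) = ln (Cmod z).
Proof.
  intros Hz. apply Cmod_gt_0 in Hz. rewrite sqmod_Cmod.
  replace (Cmod z ^ 2) with (Cmod z * Cmod z) by ring. rewrite ln_mult by auto. field.
Qed.

Lemma sqmod_div (a b : C) : b <> RtoC 0 -> sqmod (a / b)%C = sqmod a / sqmod b.
Proof.
  intros Hb. rewrite !sqmod_Cmod, Cmod_div by auto. apply Cmod_gt_0 in Hb. field. lra.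
Qed.


(** If the bound failed at [z1], then [G e] would be smaller on both boundary circles of the annulus
    [dl <= |u| <= r] than at [z1]: on the outer one because [e] is small, on the inner one because
    the logarithm tends to minus infinity. Its maximum would be interior, which [no_local_max]
    excludes. *)
Lemma schwarz (W W1 : C -> C) (l : C) (r : R) :
  0 < r -> W (RtoC 0) = RtoC 0 -> cderiv W (RtoC 0) l ->
  (forall z, z <> RtoC 0 -> Cmod z < r ->
     cderiv W z (W1 z) /\ exists m, cderiv W1 z m) ->
  (forall z, Cmod z <= r -> ccont W z /\ Cmod (W z) <= 1) ->
  forall z, Cmod z <= r -> Cmod (W z) <= Cmod z / r.
Proof.
  intros Hr W0 D0 HW Hc z1 Hz1.
  destruct (Ceq_dec z1 (RtoC 0)) as [->|N1].
  { rewrite W0, Cmod_0. unfold Rdiv. lra. }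
  apply Rnot_lt_le. intros Hbad.
  assert (P1 := proj1 (Cmod_gt_0 z1) N1).
  set (h := fun t : R => ln t + t ^ 2).
  set (G := fun e u => sqmod (W u / u)%C + e * (/ 2 * ln (sqmod u) + sqmod u)).
  assert (EG : forall e u, u <> RtoC 0 -> G e u = Cmod (W u) ^ 2 / Cmod u ^ 2 + e * h (Cmod u)).
  { intros e u Hu. unfold G, h. rewrite half_ln_sqmod, sqmod_div, !sqmod_Cmod by auto. auto. }
  assert (Hh : forall s t, 0 < s -> s <= t -> h s <= h t).
  { intros s t Hs Hst. unfold h. assert (ln s <= ln t) by (apply ln_le; auto).
    assert (s ^ 2 <= t ^ 2) by (apply pow_incr; lra). lra. }
  set (k := Cmod (W z1) ^ 2 / Cmod z1 ^ 2 - 1 / r ^ 2).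
  assert (Hk : 0 < k).
  { unfold k. apply Rlt_div_l in Hbad; auto.
    assert (X : Cmod z1 ^ 2 < (Cmod (W z1) * r) ^ 2) by (simpl; nra).
    assert (1 / r ^ 2 < Cmod (W z1) ^ 2 / Cmod z1 ^ 2); [|lra].
    apply Rlt_div_l. apply pow_lt; auto.
    unfold Rdiv. rewrite Rmult_assoc, (Rmult_comm (/ _)), <- Rmult_assoc.
    apply (Rlt_div_r 1). apply pow_lt; auto. rewrite Rmult_1_l, <- Rpow_mult_distr. exact X. }
  set (L := h r - h (Cmod z1)).
  assert (HL : 0 <= L) by (unfold L; specialize (Hh (Cmod z1) r P1 Hz1); lra).
  (* On [|u| = r] the value [G e u] is at most [G e z1 - k + e L], so [e L < k] is wanted; the added
     1 covers [L = 0]. *)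
  set (e := k / (2 * (L + 1))).
  assert (He : 0 < e) by (apply Rdiv_lt_0_compat; lra).
  assert (HeL : e * L < k).
  { assert (e * (L + 1) = k / 2) by (unfold e; field; lra). nra. }
  assert (Outer : forall u, Cmod u = r -> G e u < G e z1).
  { intros u Hu. assert (Nu : u <> RtoC 0) by (apply Cmod_gt_0; lra).
    rewrite !EG, Hu by auto. destruct (Hc u) as [_ Hw]; [lra|].
    assert (Cmod (W u) ^ 2 / r ^ 2 <= 1 / r ^ 2).
    { apply Rmult_le_compat_r. left. apply Rinv_0_lt_compat, pow_lt; auto.
      pose proof (Cmod_ge_0 (W u)). simpl; nra. }
    unfold k, L in *. nra. }
  (* Differentiability at 0 bounds [|W u / u|] by [1 + |l|] near the origin. *)
  destruct (proj1 (cderiv_eps _ _ _) D0 1 Rlt_0_1) as [d0 [Hd0 D]].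
  rewrite W0 in D. set (M := (1 + Cmod l) ^ 2).
  assert (Inner0 : forall u, u <> RtoC 0 -> Cmod u < d0 -> Cmod (W u) ^ 2 / Cmod u ^ 2 <= M).
  { intros u Hu Hud. assert (Pu := proj1 (Cmod_gt_0 u) Hu).
    specialize (D u). replace (u - RtoC 0)%C with u in D by ring. specialize (D Hud).
    apply Rle_div_l. apply pow_lt; auto. unfold M. rewrite <- Rpow_mult_distr.
    apply pow_incr. split. apply Cmod_ge_0.
    pose proof (Cmod_le_plus (W u) (l * u)). rewrite Cmod_mult in H.
    replace (W u - RtoC 0 - l * u)%C with (W u - l * u)%C in D by ring. lra. }
  (* Solves [M + e (ln q + r^2) = G e z1 - e], so an inner radius at most [q] keeps [G e] below
     [G e z1]. *)
  set (q := exp ((G e z1 - M) / e - r ^ 2 - 1)).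
  set (dl := Rmin (Rmin (d0 / 2) (Cmod z1 / 2)) q).
  assert (Q0 : 0 < q) by apply exp_pos.
  assert (Hdl : 0 < dl) by (repeat apply Rmin_glb_lt; lra).
  assert (Hdl1 : dl < d0).
  { eapply Rle_lt_trans. apply Rmin_l. eapply Rle_lt_trans. apply Rmin_l. lra. }
  assert (Hdl2 : dl < Cmod z1).
  { eapply Rle_lt_trans. apply Rmin_l. eapply Rle_lt_trans. apply Rmin_r. lra. }
  assert (Hdl3 : ln dl <= (G e z1 - M) / e - r ^ 2 - 1).
  { rewrite <- (ln_exp (_ - 1)). apply ln_le; auto. apply Rmin_r. }
  assert (Inner : forall u, Cmod u = dl -> G e u < G e z1).
  { intros u Hu. assert (Nu : u <> RtoC 0) by (apply Cmod_gt_0; lra).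
    rewrite (EG e u Nu). specialize (Inner0 u Nu ltac:(lra)).
    assert (h (Cmod u) <= (G e z1 - M) / e - 1).
    { unfold h. rewrite Hu. assert (dl ^ 2 <= r ^ 2) by (apply pow_incr; lra). lra. }
    apply (Rmult_le_compat_l e) in H; [|lra].
    replace (e * ((G e z1 - M) / e - 1)) with (G e z1 - M - e) in H by (field; lra).
    lra. }
  destruct (compact_max (fun u => dl <= Cmod u <= r) (G e) r) as [z [Hz Hmax]].
  - intros z Hz; lra.
  - intros z Hz.
    assert (Hgap : exists d, 0 < d /\ (Cmod z + d <= dl \/ r + d <= Cmod z)).
    { destruct (Rlt_dec (Cmod z) dl). exists (dl - Cmod z); lra.
      exists (Cmod z - r). lra. }
    destruct Hgap as [d [Hd Hgap]]. exists d. split; auto. intros u Hu.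
    pose proof (Cmod_le_plus u z). pose proof (Cmod_le_plus z u).
    rewrite Cmod_sub_sym in H0. lra.
  - intros z Hz eps Heps.
    assert (Nz : z <> RtoC 0) by (apply Cmod_gt_0; lra).
    set (g := fun u => sqmod (W u) * / sqmod u + e * (/ 2 * ln (sqmod u) + sqmod u)).
    assert (Cg : continuous (T := C_UniformSpace) (U := R_UniformSpace) g z).
    { assert (Cs : continuous (T := C_UniformSpace) (U := R_UniformSpace) sqmod z).
      { apply (continuous_sqmod (fun u => u)). intros e0 He0. exists e0; auto. }
      apply (continuous_plus (K := R_AbsRing) (V := R_NormedModule) (U := C_UniformSpace)
        (fun u => sqmod (W u) * / sqmod u) (fun u => e * (/ 2 * ln (sqmod u) + sqmod u))).
      - apply (continuous_mult (K := R_AbsRing) (U := C_UniformSpace)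
          (fun u => sqmod (W u)) (fun u => / sqmod u)).
        + apply continuous_sqmod. apply Hc; lra.
        + apply (continuous_comp (U := C_UniformSpace) (V := R_UniformSpace)
            (W := R_UniformSpace) sqmod Rinv); auto.
          apply continuous_Rinv. pose proof (sqmod_pos z Nz). lra.
      - apply (continuous_comp (U := C_UniformSpace) (V := R_UniformSpace)
          (W := R_UniformSpace) sqmod (fun t => e * (/ 2 * ln t + t))); auto.
        apply (ex_derive_continuous (K := R_AbsRing) (V := R_NormedModule)).
        auto_derive. pose proof (sqmod_pos z Nz). lra. }
    destruct (Cg _ (locally_ball (g z) (mkposreal _ Heps))) as [d D1].
    exists (Rmin d (Cmod z)). split. { apply Rmin_glb_lt; [apply cond_pos|lra]. }
    intros u Hu.
    assert (Hu1 := Rlt_le_trans _ _ _ Hu (Rmin_l _ _)).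
    assert (Hu2 := Rlt_le_trans _ _ _ Hu (Rmin_r _ _)).
    assert (Nu : u <> RtoC 0).
    { intros ->. rewrite Cmod_sub_sym in Hu2.
      replace (z - RtoC 0)%C with z in Hu2 by ring. lra. }
    specialize (D1 u (C_NormedModule_mixin_compat1 z u d Hu1)).
    change (Rabs (g u - g z) < eps) in D1. apply Rabs_lt_between in D1.
    unfold G. rewrite !sqmod_div by auto. unfold g, Rdiv in *. lra.
  - exists z1. lra.
  - assert (Nz : z <> RtoC 0) by (apply Cmod_gt_0; lra).
    assert (H1 := Hmax z1 ltac:(lra)).
    assert (Cmod z < r).
    { destruct (Rle_lt_or_eq_dec (Cmod z) r) as [|E]; [lra|auto|].
      specialize (Outer z E). lra. }
    assert (dl < Cmod z).
    { destruct (Rle_lt_or_eq_dec dl (Cmod z)) as [|E]; [lra|auto|].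
      symmetry in E. specialize (Inner z E). lra. }
    destruct (HW z Nz H) as [_ [m Hm]].
    assert (DF : forall u, u <> RtoC 0 -> Cmod u < r ->
      cderiv (fun u => W u / u)%C u ((W1 u * u - W u) / (u * u))%C).
    { intros u Hu Hur. eapply cderiv_eq.
      apply (cderiv_div W (fun u => u)); auto. apply (HW u Hu Hur). apply cderiv_id.
      simpl. field. auto. }
    set (d := Rmin (r - Cmod z) (Cmod z - dl)).
    assert (Hd : 0 < d) by (apply Rmin_glb_lt; lra).
    assert (Hann : forall u, Cmod (u - z) < d -> dl < Cmod u < r).
    { intros u Hu. pose proof (Cmod_le_plus u z). pose proof (Cmod_le_plus z u).
      rewrite Cmod_sub_sym in H3.
      pose proof (Rmin_l (r - Cmod z) (Cmod z - dl)). fold d in H4.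
      pose proof (Rmin_r (r - Cmod z) (Cmod z - dl)). fold d in H5. lra. }
    eapply (no_local_max (fun u => W u / u)%C (fun u => (W1 u * u - W u) / (u * u))%C
      _ z e d Nz He Hd).
    + intros u Hu. specialize (Hann u Hu). apply DF; [apply Cmod_gt_0|]; lra.
    + apply (cderiv_div (fun u => W1 u * u - W u)%C (fun u => u * u)%C).
      * apply (cderiv_minus (fun u => W1 u * u)%C W).
        apply (cderiv_mult W1 (fun u => u)). exact Hm. apply cderiv_id.
        apply (HW z Nz H).
      * apply (cderiv_mult (fun u => u) (fun u => u)); apply cderiv_id.
      * apply Cmult_neq_0; auto.
    + intros u Hu. specialize (Hann u Hu). apply (Hmax u). lra.
Qed.

(** By [schwarz], [|W (z0 c)| <= |c|] for [|c| <= 1], with equality at [c = 1]. Moving [c] from 1 in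
    a direction [v] with [Re v < 0] and comparing derivatives of the squares gives
    [Re (A v) <= Re v]. Since [|W z0| = 1], [A] is the quotient [z0 W'(z0) / W z0]. *)
Lemma jack_lemma (W W1 : C -> C) (l z0 : C) (r : R) :
  0 < r -> W (RtoC 0) = RtoC 0 -> cderiv W (RtoC 0) l ->
  (forall z, z <> RtoC 0 -> Cmod z <= r ->
     cderiv W z (W1 z) /\ exists m, cderiv W1 z m) ->
  (forall z, Cmod z <= r -> Cmod (W z) <= 1) ->
  Cmod z0 = r -> Cmod (W z0) = 1 ->
  let A := (Cconj (W z0) * (z0 * W1 z0))%C in Im A = 0 /\ 1 <= Re A.
Proof.
  intros Hr W0 D0 HW HW1 Hz0 HWz A.
  assert (N0 : z0 <> RtoC 0) by (apply Cmod_gt_0; lra).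
  assert (Hs : forall z, Cmod z <= r -> Cmod (W z) <= Cmod z / r).
  { apply (schwarz W W1 l); auto.
    - intros z Hz Hzr. apply HW; auto. lra.
    - intros z Hz. split; auto.
      destruct (Ceq_dec z (RtoC 0)) as [->|Nz]. eapply cderiv_ccont, D0.
      destruct (HW z Nz Hz) as [H _]. eapply cderiv_ccont, H. }
  assert (Dir : forall v : C, Re v < 0 -> Re (A * v)%C <= Re v).
  { intros v Hv.
    pose (g := fun t : R => sqmod (W (z0 + RtoC t * (z0 * v))%C)
                            - sqmod (RtoC 1 + RtoC t * v)%C).
    assert (E0 : (z0 + RtoC 0 * (z0 * v))%C = z0) by ring.
    destruct (cderiv_line W z0 (z0 * v) (W1 z0) 0) as [DR DI].
    { rewrite E0. apply HW; auto. lra. }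
    set (a := fun s : R => Re (W (z0 + RtoC s * (z0 * v))%C)) in *.
    set (b := fun s : R => Im (W (z0 + RtoC s * (z0 * v))%C)) in *.
    assert (Dg : is_derive g 0 (2 * (Re (A * v)%C - Re v))).
    { apply is_derive_ext with
       (f := fun t => a t * a t + b t * b t - ((1 + t * Re v) * (1 + t * Re v) + (t * Im v) * (t * Im v))).
      { intros t. unfold g, a, b, sqmod. unfold Re, Im; simpl. ring. }
      auto_derive.
      - repeat split; auto; eexists; eauto.
      - rewrite (is_derive_unique (fun x : R => a x) _ _ DR),
          (is_derive_unique (fun x : R => b x) _ _ DI).
        unfold a, b. rewrite E0. unfold A, Re, Im; simpl. ring. }
    assert (G0 : g 0 = 0).
    { unfold g. rewrite E0. rewrite (sqmod_Cmod (W z0)), HWz. unfold sqmod; simpl. ring. }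
    assert (Ps : 0 < sqmod v).
    { apply sqmod_pos. intros ->. simpl in Hv. lra. }
    assert (H : 2 * (Re (A * v)%C - Re v) <= 0); [|lra].
    (* For [t] up to this bound, [|1 + t v|^2 = 1 + 2 t Re v + t^2 |v|^2 <= 1]. *)
    apply right_max_deriv with g (- 2 * Re v / sqmod v); auto.
    - apply Rdiv_lt_0_compat; lra.
    - intros t [Ht1 Ht2]. rewrite G0. unfold g.
      apply Rlt_div_r in Ht2; auto.
      assert (Hle : sqmod (RtoC 1 + RtoC t * v)%C <= 1).
      { unfold sqmod in *. unfold Re, Im in *; simpl. nra. }
      replace (z0 + RtoC t * (z0 * v))%C with (z0 * (RtoC 1 + RtoC t * v))%C by ring.
      set (c := (RtoC 1 + RtoC t * v)%C) in *.
      rewrite sqmod_Cmod in Hle. rewrite !sqmod_Cmod. pose proof (Cmod_ge_0 c).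
      assert (Cmod c <= 1) by (simpl in Hle; nra).
      specialize (Hs (z0 * c)%C). rewrite Cmod_mult, Hz0 in Hs.
      replace (r * Cmod c / r) with (Cmod c) in Hs by (field; lra).
      specialize (Hs ltac:(nra)). pose proof (Cmod_ge_0 (W (z0 * c)%C)).
      assert (Cmod (W (z0 * c)%C) ^ 2 <= Cmod c ^ 2) by (apply pow_incr; lra). lra. }
  (* The direction [-1] gives [Re A >= 1]; the directions [- e + i] and [- e - i], with [e] tending
     to 0, squeeze [Im A] to 0. *)
  clearbody A. assert (D1 := Dir (-1, 0) ltac:(simpl; lra)).
  assert (HR : 1 <= Re A) by (unfold Re in *; simpl in D1; lra).
  split; auto.
  assert (Small : forall s e, s * s = 1 -> 0 < e -> - s * Im A <= e * Re A).
  { intros s e Hse He. specialize (Dir (- e, s) ltac:(simpl; lra)).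
    unfold Re, Im in *. simpl in Dir. lra. }
  assert (Small2 : forall e, 0 < e -> Rabs (Im A) <= e).
  { intros e He. assert (0 < e / Re A) by (apply Rdiv_lt_0_compat; lra).
    pose proof (Small 1 _ ltac:(lra) H). pose proof (Small (-1) _ ltac:(lra) H).
    replace (e / Re A * Re A) with e in * by (field; lra).
    apply Rabs_le_between. lra. }
  destruct (Req_dec (Im A) 0) as [|N]; auto.
  apply Rabs_pos_lt in N. specialize (Small2 (Rabs (Im A) / 2) ltac:(lra)). lra.
Qed.

(** * Differential subordination *)

(** For [w = a + i b] the real part vanishes when [b^2 = a^2 + 2 a]. The squared imaginary part is
    then [16/9 (x - 1) x] with [x = (1 + a)^2], increasing in [a >= 0], and its value at the extreme
    [a = (sqrt 3 - 1) / 2] is the stated constant. *)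
Lemma phi_CAR_axis (w : C) :
  Cmod w < 1 -> Re (phi_CAR w - RtoC 1)%C = 0 ->
  Im (phi_CAR w - RtoC 1)%C ^ 2 < (4 * sqrt 3 + 8) / (3 * sqrt 3).
Proof.
  intros Hw. set (s := sqrt 3).
  assert (Hs : s * s = 3) by (apply sqrt_sqrt; lra).
  assert (Hs0 : 0 < s) by (apply sqrt_lt_R0; lra).
  pose proof (Cmod2_alt w) as H2. pose proof (Cmod_ge_0 w).
  assert (Hw2 : Re w ^ 2 + Im w ^ 2 < 1) by (rewrite <- H2; simpl; nra).
  destruct w as [a b]. unfold Re, Im in *. simpl in Hw2.
  assert (E : (phi_CAR (a, b) - RtoC 1)%C
    = (4 * a / 3 + 2 * (a * a - b * b) / 3, 4 * b * (1 + a) / 3)).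
  { unfold phi_CAR. apply injective_projections; simpl; field. }
  rewrite E; simpl. intros H0.
  assert (Hb : b * b = a * a + 2 * a) by lra.
  replace (4 * b * (1 + a) / 3 * (4 * b * (1 + a) / 3 * 1))
    with (16 / 9 * (b * b) * ((1 + a) * (1 + a))) by field.
  rewrite Hb.
  assert (Hi : / s = s / 3).
  { apply Rmult_eq_reg_l with s; [|lra]. rewrite Rinv_r; lra. }
  replace ((4 * s + 8) / (3 * s)) with (4 / 3 + 8 / 3 * / s) by (field; lra).
  rewrite Hi.
  (* With [b^2 = a^2 + 2 a], the condition [a^2 + b^2 < 1] reads [2 a^2 + 2 a < 1]. *)
  assert (Ha : a < (s - 1) / 2) by nra.
  assert (Ha0 : 0 <= a) by nra.
  set (x := (1 + a) * (1 + a)).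
  replace (a * a + 2 * a) with (x - 1) by (unfold x; ring).
  assert (Hx : x < (2 + s) / 2) by (unfold x; nra).
  assert (1 <= x) by (unfold x; nra).
  assert ((x - 1) * x < ((2 + s) / 2 - 1) * ((2 + s) / 2)) by nra.
  nra.
Qed.

Lemma phi_CAR_bound (w : C) : Cmod w < 1 -> Cmod (phi_CAR w - RtoC 1) <= 2.
Proof.
  intros Hw. unfold phi_CAR.
  replace (1 + 4 * w / 3 + 2 * w ^ 2 / 3 - RtoC 1)%C
    with (RtoC (4 / 3) * w + RtoC (2 / 3) * (w * w))%C.
  - eapply Rle_trans. apply Cmod_triangle. rewrite !Cmod_mult, !Cmod_R, !Rabs_pos_eq by lra.
    pose proof (Cmod_ge_0 w). nra.
  - destruct w as [a b]. apply injective_projections; simpl; field.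
Qed.

Lemma Re_Im_scaled (t : R) (d q c : C) :
  (RtoC t * d)%C = (q * c)%C ->
  t * Re d = Re q * Re c - Im q * Im c /\ t * Im d = Re q * Im c + Im q * Re c.
Proof.
  intros H. split.
  - apply (f_equal Re) in H. unfold Re, Im in *; simpl in H. lra.
  - apply (f_equal Im) in H. unfold Re, Im in *; simpl in H. lra.
Qed.

(* [t^4 |p (t z1)|^2] is nondecreasing in [t], so a zero at [z1] would propagate to the origin. *)
Lemma log_derivative_bounded_nonzero (p dp : C -> C) :
  (forall z, Cmod z < 1 -> cderiv p z (dp z)) ->
  (forall z, Cmod z < 1 -> Cmod (z * dp z / p z) <= 2) ->
  p (RtoC 0) <> RtoC 0 -> forall z, Cmod z < 1 -> p z <> RtoC 0.
Proof.
  intros Hp Hq H0 z Hz Ez.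
  pose (a := fun t : R => Re (p (RtoC 0 + RtoC t * z)%C)).
  pose (b := fun t : R => Im (p (RtoC 0 + RtoC t * z)%C)).
  pose (D := fun t : R => (dp (RtoC 0 + RtoC t * z) * z)%C).
  assert (In : forall t, 0 < t <= 1 -> Cmod (RtoC 0 + RtoC t * z) < 1).
  { intros t Ht. rewrite Cplus_0_l, Cmod_mult, Cmod_R, Rabs_pos_eq by lra.
    pose proof (Cmod_ge_0 z). nra. }
  (* With [Q = u p'(u) / p(u)] at [u = t z], [t (|p|^2)' = 2 Re Q |p|^2 >= - 4 |p|^2]; the exponent
     4 compensates this. *)
  pose (g := fun t => t ^ 4 * (a t * a t + b t * b t)).
  pose (g' := fun t => 4 * t ^ 3 * (a t * a t + b t * b t)
                       + t ^ 4 * (2 * (a t * Re (D t) + b t * Im (D t)))).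
  assert (Dg : forall t, 0 < t <= 1 -> is_derive g t (g' t)).
  { intros t Ht. destruct (cderiv_line p (RtoC 0) z (dp (RtoC 0 + RtoC t * z)%C) t (Hp _ (In t Ht)))
      as [DR DI].
    fold a in DR. fold b in DI. fold (D t) in DR, DI. unfold g, g'. auto_derive.
    - repeat split; auto; eexists; eauto.
    - rewrite (is_derive_unique (fun x : R => a x) _ _ DR),
        (is_derive_unique (fun x : R => b x) _ _ DI). ring. }
  assert (g'_pos : forall t, 0 < t <= 1 -> 0 <= g' t).
  { intros t Ht. set (u := (RtoC 0 + RtoC t * z)%C) in *.
    (* At a zero of [p] the bound on the quotient says nothing, but both terms of [g' t] vanish
       there. *)
    destruct (Ceq_dec (p u) (RtoC 0)) as [E|N].
    - unfold g', a, b. fold u. rewrite E. simpl. lra.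
    - set (Q := (u * dp u / p u)%C).
      assert (HQ : (RtoC t * D t)%C = (Q * p u)%C).
      { unfold Q, D. fold u. replace (Q * p u)%C with (u * dp u)%C by (unfold Q; field; auto).
        unfold u at 2. field. auto. }
      assert (Hb : -2 <= Re Q).
      { pose proof (re_le_Cmod Q) as X. apply Rabs_le_between in X.
        specialize (Hq u (In t Ht)). fold Q in Hq. lra. }
      destruct (Re_Im_scaled _ _ _ _ HQ) as [HR HI].
      change (Re (p u)) with (a t) in HR, HI. change (Im (p u)) with (b t) in HR, HI.
      replace (g' t) with (t ^ 3 * (2 * (2 + Re Q) * (a t * a t + b t * b t))).
      + apply Rmult_le_pos; [apply pow_le; lra|].
        apply Rmult_le_pos; [lra|].
        apply Rplus_le_le_0_compat; apply Rle_0_sqr.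
      + unfold g'. transitivity (4 * t ^ 3 * (a t * a t + b t * b t)
          + 2 * t ^ 3 * (a t * (t * Re (D t)) + b t * (t * Im (D t)))); [|ring].
        rewrite HR, HI. ring. }
  (* Monotonicity gives [g t <= g 1 = 0], while [g t] is [t^4] times a sum of squares. The zeros on
     the whole segment then contradict continuity at the origin. *)
  assert (Zero : forall t, 0 < t < 1 -> p (RtoC 0 + RtoC t * z)%C = RtoC 0).
  { intros t Ht. destruct (MVT_cor2 g g' t 1) as [c [Hc1 Hc2]]; [lra| |].
    { intros c Hc. apply is_derive_Reals, Dg. lra. }
    specialize (g'_pos c ltac:(lra)).
    assert (g 1 = 0).
    { unfold g, a, b. replace (RtoC 0 + RtoC 1 * z)%C with z by ring. rewrite Ez. simpl. ring. }
    assert (0 <= g' c * (1 - t)) by (apply Rmult_le_pos; lra).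
    assert (Hg : g t <= 0) by lra.
    assert (0 < t ^ 4) by (apply pow_lt; lra).
    unfold g in Hg. assert (a t * a t + b t * b t <= 0) by nra.
    assert (a t = 0) by nra. assert (b t = 0) by nra.
    apply injective_projections; auto. }
  destruct (ccont_nonzero p (RtoC 0)) as [d [Hd Hn]]; auto.
  { eapply cderiv_ccont, Hp. rewrite Cmod_0. lra. }
  apply Cmod_gt_0 in H0.
  set (t := Rmin (1 / 2) (d / 2)).
  assert (Ht : 0 < t) by (apply Rmin_glb_lt; lra).
  pose proof (Rmin_l (1 / 2) (d / 2)). pose proof (Rmin_r (1 / 2) (d / 2)). fold t in H, H1.
  specialize (Hn (RtoC 0 + RtoC t * z)%C). rewrite (Zero t ltac:(lra)), Cmod_0 in Hn.
  replace (RtoC 0 + RtoC t * z - RtoC 0)%C with (RtoC t * z)%C in Hn by ring.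
  rewrite Cmod_mult, Cmod_R, Rabs_pos_eq in Hn by lra.
  pose proof (Cmod_ge_0 z). specialize (Hn ltac:(nra)). lra.
Qed.

(** * Powers, sectors and the Cayley transform *)

Lemma cderiv_Cpower (z : C) (a : R) :
  slit z -> cderiv (fun u => Cpower u a) z (RtoC a * Cpower z a / z)%C.
Proof.
  intros Hz. assert (N := slit_neq_0 z Hz). eapply cderiv_eq.
  - apply (cderiv_comp Cexp (fun u => RtoC a * Cln u)%C).
    apply cderiv_Cexp. apply (cderiv_mult (fun _ => RtoC a) Cln).
    apply cderiv_const. apply cderiv_Cln; auto.
  - simpl. unfold Cpower. field. auto.
Qed.

(** The range condition keeps [a Cln z] in the principal strip, where [Cln] undoes [Cexp]. *)
Lemma Cpower_Cpower (z : C) (a b : R) :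
  z <> RtoC 0 -> - PI < a * Carg z <= PI -> a * b = 1 -> Cpower (Cpower z a) b = z.
Proof.
  intros Hz Ha Hab. unfold Cpower. rewrite Cln_Cexp.
  - rewrite Cmult_assoc, <- RtoC_mult, (Rmult_comm b), Hab, Cmult_1_l. apply Cexp_Cln; auto.
  - simpl. lra.
Qed.

Lemma Cpower_1 (a : R) : Cpower (RtoC 1) a = RtoC 1.
Proof. unfold Cpower. rewrite Cln_1, Cmult_0_r. apply Cexp_0. Qed.

Lemma Re_Cpower (z : C) (a : R) :
  Re (Cpower z a) = exp (a * ln (Cmod z)) * cos (a * Carg z).
Proof. unfold Cpower, Cexp; simpl. f_equal; f_equal; ring. Qed.

(** The Moebius map of the right half-plane onto the unit disc, inverse to
    [w -> (1 + w) / (1 - w)]. *)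
Definition cayley (g : C) : C := ((g - RtoC 1) / (g + RtoC 1))%C.

Lemma cayley_den (g : C) : 0 <= Re g -> (g + RtoC 1)%C <> RtoC 0.
Proof. intros H E. apply (f_equal Re) in E. simpl in E. unfold Re in *. lra. Qed.

(** All three cases come from [|g + 1|^2 = |g - 1|^2 + 4 Re g]. *)
Lemma cayley_mod (g : C) :
  0 <= Re g -> Cmod (cayley g) <= 1 /\ (0 < Re g -> Cmod (cayley g) < 1) /\
  (Re g = 0 -> Cmod (cayley g) = 1).
Proof.
  intros H. assert (N := cayley_den g H).
  assert (P := proj1 (Cmod_gt_0 _) N).
  unfold cayley. rewrite Cmod_div by auto.
  assert (E : Cmod (g + RtoC 1) ^ 2 = Cmod (g - RtoC 1) ^ 2 + 4 * Re g).
  { rewrite <- !sqmod_Cmod. unfold sqmod, Re, Im; simpl. ring. }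
  pose proof (Cmod_ge_0 (g - RtoC 1)).
  set (x := Cmod (g - RtoC 1)) in *. set (y := Cmod (g + RtoC 1)) in *.
  repeat split.
  - apply Rle_div_l; auto. simpl in E. nra.
  - intros H'. apply Rlt_div_l; auto. simpl in E. nra.
  - intros H'. assert (x = y) by (simpl in E; nra). rewrite H1. field. lra.
Qed.

Lemma cayley_inv (g : C) :
  (g + RtoC 1)%C <> RtoC 0 -> ((RtoC 1 + cayley g) / (RtoC 1 - cayley g))%C = g.
Proof.
  intros N. assert (RtoC 2 <> RtoC 0) by (intros E; apply RtoC_inj in E; lra).
  assert (E1 : (RtoC 1 + cayley g)%C = (RtoC 2 * g / (g + RtoC 1))%C).
  { unfold cayley. replace (RtoC 2) with (RtoC 1 + RtoC 1)%C
      by (rewrite <- RtoC_plus; f_equal; ring). field. auto. }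
  assert (E2 : (RtoC 1 - cayley g)%C = (RtoC 2 / (g + RtoC 1))%C).
  { unfold cayley. replace (RtoC 2) with (RtoC 1 + RtoC 1)%C
      by (rewrite <- RtoC_plus; f_equal; ring). field. auto. }
  rewrite E1, E2. field. auto.
Qed.

(** For [g = p^a], [g' = a g p' / p] and [1 - W^2 = 4 g / (g + 1)^2], so the derivative
    [2 g' / (g + 1)^2] is expressed by [W] and [p' / p] alone. *)
Lemma cderiv_cayley_Cpower (p : C -> C) (z d : C) (a : R) :
  cderiv p z d -> slit (p z) -> (Cpower (p z) a + RtoC 1)%C <> RtoC 0 ->
  let W := fun u => cayley (Cpower (p u) a) in
  cderiv W z ((RtoC 1 - W z * W z) * (RtoC (a / 2) * d / p z))%C.
Proof.
  intros Hp Hs N W. assert (N' := slit_neq_0 _ Hs).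
  assert (Dg : cderiv (fun u => Cpower (p u) a) z (RtoC a * Cpower (p z) a / p z * d)%C).
  { apply (cderiv_comp (fun u => Cpower u a) p); auto. apply cderiv_Cpower; auto. }
  eapply cderiv_eq.
  - apply (cderiv_div (fun u => Cpower (p u) a - RtoC 1)%C (fun u => Cpower (p u) a + RtoC 1)%C).
    apply (cderiv_minus (fun u => Cpower (p u) a) (fun _ => RtoC 1)); [exact Dg|apply cderiv_const].
    apply (cderiv_plus (fun u => Cpower (p u) a) (fun _ => RtoC 1)); [exact Dg|apply cderiv_const].
    exact N.
  - simpl. unfold W, cayley. set (g := Cpower (p z) a) in *.
    replace (RtoC a) with (RtoC (a / 2) + RtoC (a / 2))%C
      by (rewrite <- RtoC_plus; f_equal; field).
    field. auto.
Qed.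

(** Approaching [z] along [(1 - t) z] carries the sector bounds from an open disc to its boundary
    circle. *)
Lemma Re_closed_radial (f : C -> C) (z : C) (c : R) :
  z <> RtoC 0 -> ccont f z -> (forall u, Cmod u < Cmod z -> Re (f u) <= c) -> Re (f z) <= c.
Proof.
  intros Nz Hf H. apply Rnot_lt_le. intros Hc. apply Cmod_gt_0 in Nz.
  destruct (Hf (Re (f z) - c)) as [d [Hd D]]; [lra|].
  set (t := Rmin (1 / 2) (d / (2 * Cmod z))).
  assert (Ht : 0 < t).
  { apply Rmin_glb_lt; [lra|]. apply Rdiv_lt_0_compat; lra. }
  pose proof (Rmin_l (1 / 2) (d / (2 * Cmod z))) as T1. fold t in T1.
  assert (T2 : t * (2 * Cmod z) <= d).
  { apply Rle_div_r. lra. apply Rmin_r. }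
  specialize (H (RtoC (1 - t) * z)%C). specialize (D (RtoC (1 - t) * z)%C).
  replace (RtoC (1 - t) * z - z)%C with (RtoC (- t) * z)%C in D
    by (rewrite RtoC_minus, RtoC_opp; ring).
  rewrite Cmod_mult, Cmod_R, Rabs_Ropp, Rabs_pos_eq in D by lra.
  rewrite Cmod_mult, Cmod_R, Rabs_pos_eq in H by lra.
  specialize (D ltac:(nra)). specialize (H ltac:(nra)).
  pose proof (re_le_Cmod (f (RtoC (1 - t) * z) - f z)%C) as X.
  apply Rabs_le_between in X. unfold Re in *; simpl in X. lra.
Qed.

Lemma ccont_Cln_comp (p : C -> C) (d z : C) :
  cderiv p z d -> slit (p z) -> ccont (fun u => Cln (p u)) z.
Proof.
  intros Hp Hs. eapply cderiv_ccont.
  apply (cderiv_comp Cln p). apply cderiv_Cln; auto. exact Hp.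
Qed.

(** The power [1 / alpha] opens the sector to the right half-plane: the argument is divided by
    [alpha], and the sign of the real part is that of its cosine. *)
Lemma Re_Cpower_sector (z : C) (alpha : R) :
  0 < alpha -> Rabs (Carg z) <= alpha * (PI / 2) ->
  0 <= Re (Cpower z (1 / alpha)) /\
  (Rabs (Carg z) < alpha * (PI / 2) -> 0 < Re (Cpower z (1 / alpha))) /\
  (Rabs (Carg z) = alpha * (PI / 2) -> Re (Cpower z (1 / alpha)) = 0).
Proof.
  intros Ha Hz. rewrite Re_Cpower.
  pose proof (exp_pos (1 / alpha * ln (Cmod z))) as He.
  assert (Ec : cos (1 / alpha * Carg z) = cos (1 / alpha * Rabs (Carg z))).
  { unfold Rabs. destruct Rcase_abs; auto.
    rewrite Ropp_mult_distr_r_reverse, cos_neg; auto. }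
  rewrite Ec.
  assert (Hi : 0 < 1 / alpha) by (apply Rdiv_lt_0_compat; lra).
  assert (E1 : 1 / alpha * (alpha * (PI / 2)) = PI / 2) by (field; lra).
  pose proof (Rabs_pos (Carg z)) as H0. pose proof PI_RGT_0.
  set (t := Rabs (Carg z)) in *.
  assert (0 <= 1 / alpha * t) by (apply Rmult_le_pos; lra).
  assert (L : 1 / alpha * t <= PI / 2).
  { rewrite <- E1. apply Rmult_le_compat_l; lra. }
  repeat split.
  - apply Rmult_le_pos; [lra|]. apply cos_ge_0; lra.
  - intros H'. apply Rmult_lt_0_compat; auto. apply cos_gt_0; [lra|].
    rewrite <- E1. apply Rmult_lt_compat_l; lra.
  - intros ->. rewrite E1, cos_PI2. ring.
Qed.

Lemma Carg_1 : Carg (RtoC 1) = 0.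
Proof. change (Im (Cln (RtoC 1)) = 0). rewrite Cln_1. reflexivity. Qed.

(** * Confinement of [p] to the sector, and the subordination *)

Section Sector.

Variables (alpha : R) (p dp q : C -> C).
Hypothesis Halpha : 0 < alpha <= 1.
Hypothesis Hp : forall z, Cmod z < 1 -> cderiv p z (dp z).
Hypothesis Hp0 : p (RtoC 0) = RtoC 1.
Hypothesis Hpn : forall z, Cmod z < 1 -> p z <> RtoC 0.
Hypothesis Hpq : forall z, Cmod z < 1 -> (z * dp z)%C = (q z * p z)%C.
(** Together with [p' = q p / z] this provides the second derivative of [p] away from the origin. *)
Hypothesis Hq : forall z, Cmod z < 1 -> exists l, cderiv q z l.
Hypothesis Hslit : forall z, Cmod z < 1 -> Re (q z) = 0 -> Rabs (Im (q z)) < alpha.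

(** The solution [w] of [p = ((1 + w) / (1 - w))^alpha]: Jack's lemma is applied to it, and it is
    the function that realises the subordination. *)
Let W := fun u => cayley (Cpower (p u) (1 / alpha)).

Lemma cderiv_W_sector (z : C) :
  Cmod z < 1 -> slit (p z) -> Rabs (Carg (p z)) <= alpha * (PI / 2) ->
  exists l, cderiv W z l.
Proof.
  intros Hz Hs Hc. eexists. apply (cderiv_cayley_Cpower p z (dp z) (1 / alpha)); auto.
  apply cayley_den. apply Re_Cpower_sector; [lra|auto].
Qed.

Lemma W_0 : W (RtoC 0) = RtoC 0.
Proof.
  unfold W. rewrite Hp0, Cpower_1. unfold cayley.
  replace (RtoC 1 - RtoC 1)%C with (RtoC 0) by ring. unfold Cdiv. ring.
Qed.

Lemma sector_bound (z1 : C) : Cmod z1 < 1 -> Rabs (Carg (p z1)) < alpha * (PI / 2).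
Proof.
  intros Hz1. apply Rnot_le_lt. intros Hbad.
  pose proof PI_RGT_0 as HPI.
  assert (Hpi : 0 < alpha * (PI / 2) <= PI / 2) by nra.
  (* Maximising [- |u|] yields a point [z0] of least modulus among those where [p] is not strictly
     inside the sector. *)
  destruct (compact_max
    (fun u => Cmod u <= Cmod z1 /\ alpha * (PI / 2) <= Rabs (Carg (p u)))
    (fun u => - Cmod u) (Cmod z1)) as [z0 [[Hz0 Hc0] Hmin]].
  - intros z [H _]; auto.
  - intros z Hz. destruct (Rlt_dec (Cmod z1) (Cmod z)) as [L|L].
    + exists (Cmod z - Cmod z1). split; [lra|]. intros u Hu [H _].
      pose proof (Cmod_le_plus z u) as X. rewrite Cmod_sub_sym in X. lra.
    (* Here [p z] is strictly inside the sector, hence off the branch cut, so the argument is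
       continuous at [z] and nearby points stay inside. *)
    + assert (Hlt : Rabs (Carg (p z)) < alpha * (PI / 2)).
      { apply Rnot_le_lt. intros H. apply Hz. split; lra. }
      assert (Hz' : Cmod z < 1) by lra.
      assert (Hs : slit (p z)) by (left; apply Carg_lt_half; [auto|lra]).
      destruct (ccont_Cln_comp p (dp z) z (Hp z Hz') Hs (alpha * (PI / 2) - Rabs (Carg (p z))))
        as [d [Hd D]]; [lra|].
      exists d. split; auto. intros u Hu [_ H]. specialize (D u Hu).
      pose proof (im_le_Cmod (Cln (p u) - Cln (p z))%C) as X. simpl in X.
      pose proof (Rabs_triang_inv (Carg (p u)) (Carg (p z))). unfold Rminus in *. lra.
  - intros z _ eps Heps. exists eps. split; auto. intros u Hu.
    pose proof (Cmod_le_plus z u) as X. rewrite Cmod_sub_sym in X. lra.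
  - exists z1. split; lra.
  - set (r := Cmod z0) in *.
    assert (Small : forall u, Cmod u < r -> Rabs (Carg (p u)) < alpha * (PI / 2)).
    { intros u Hu. apply Rnot_le_lt. intros H. specialize (Hmin u). lra. }
    assert (Nz0 : z0 <> RtoC 0).
    { intros E. rewrite E, Hp0, Carg_1, Rabs_R0 in Hc0. lra. }
    assert (Hr : 0 < r) by (apply Cmod_gt_0; auto).
    assert (In : forall u, Cmod u <= r -> Cmod u < 1) by (intros; lra).
    assert (Sl : forall u, Cmod u <= r -> slit (p u)).
    { intros u Hu. assert (Nu := Hpn u (In u Hu)).
      destruct (Rle_lt_or_eq_dec _ _ Hu) as [L|L].
      - left. apply Carg_lt_half; auto. specialize (Small u L). lra.
      (* On the circle the limit leaves only [Re (p u) >= 0]; as [p u] is not 0, it still avoids the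
         cut. *)
      - assert (Hle : Re (- p u)%C <= 0).
        { apply (Re_closed_radial (fun u => - p u)%C).
          - apply Cmod_gt_0; lra.
          - eapply cderiv_ccont, cderiv_opp, Hp. auto.
          - intros v Hv. rewrite L in Hv. specialize (Small v Hv).
            assert (0 < Re (p v)) by (apply Carg_lt_half; [apply Hpn|]; lra).
            unfold Re in *; simpl. lra. }
        unfold slit. destruct (Req_dec (Im (p u)) 0) as [Hi|]; auto. left.
        destruct (Req_dec (Re (p u)) 0) as [Hre|]; [|unfold Re in *; simpl in Hle; lra].
        exfalso. apply Nu. apply injective_projections; auto. }
    assert (Bd : forall u, Cmod u <= r -> Rabs (Carg (p u)) <= alpha * (PI / 2)).
    { intros u Hu. destruct (Rle_lt_or_eq_dec _ _ Hu) as [L|L].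
      - left. auto.
      - assert (Nu : u <> RtoC 0) by (apply Cmod_gt_0; lra).
        assert (HC : forall c : C, exists l, cderiv (fun u => c * Cln (p u))%C u l).
        { intros c. eexists. apply (cderiv_mult (fun _ => c) (fun u => Cln (p u))).
          apply cderiv_const. apply (cderiv_comp Cln p). apply cderiv_Cln; auto. auto. }
        assert (Both : forall s, s = 1 \/ s = -1 -> s * Carg (p u) <= alpha * (PI / 2)).
        (* Multiplication by [- s i] makes [s] times the argument the real part of a continuous
           function. *)
        { intros s Hs. pose (c := (0, - s) : C).
          replace (s * Carg (p u)) with (Re (c * Cln (p u))%C) by (simpl; ring).
          apply (Re_closed_radial (fun u => c * Cln (p u))%C); auto.
          - destruct (HC c) as [l Hl]. eapply cderiv_ccont, Hl.
          - intros v Hv. rewrite L in Hv. specialize (Small v Hv).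
            apply Rabs_lt_between in Small. simpl.
            destruct Hs as [-> | ->]; lra. }
        pose proof (Both 1 (or_introl eq_refl)). pose proof (Both (-1) (or_intror eq_refl)).
        apply Rabs_le_between. lra. }
    assert (RePos : forall u, Cmod u <= r -> 0 <= Re (Cpower (p u) (1 / alpha))).
    { intros u Hu. apply Re_Cpower_sector; [lra|auto]. }
    (* This is [W'] with [p' / p] replaced by [q / u], a form that can be differentiated once more
       away from 0. *)
    set (W1 := fun u => ((RtoC 1 - W u * W u) * (RtoC (1 / alpha / 2) * (q u / u)))%C).
    assert (DW : forall u, u <> RtoC 0 -> Cmod u <= r -> cderiv W u (W1 u)).
    { intros u Nu Hu. eapply cderiv_eq.
      - apply (cderiv_cayley_Cpower p u (dp u) (1 / alpha)); auto.
        apply cayley_den; auto.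
      - fold W. unfold W1. assert (Np := Hpn u (In u Hu)).
        replace (dp u) with (q u * p u / u)%C by (rewrite <- Hpq by auto; field; auto).
        field. auto. }
    assert (DW0 : exists l, cderiv W (RtoC 0) l).
    { apply cderiv_W_sector. rewrite Cmod_0; lra.
      apply Sl. rewrite Cmod_0; lra. apply Bd. rewrite Cmod_0; lra. }
    destruct DW0 as [l DW0].
    assert (HW1 : Cmod (W z0) = 1).
    { apply cayley_mod. apply RePos. unfold r; lra.
      apply Re_Cpower_sector; [lra| |].
      apply Bd. unfold r; lra. apply Rle_antisym; auto. apply Bd. unfold r; lra. }
    destruct (jack_lemma W W1 l z0 r) as [JI JR]; auto.
    + apply W_0.
    + intros u Nu Hu. split; auto. destruct (Hq u (In u Hu)) as [m Hm].
      eexists. apply (cderiv_mult (fun u => RtoC 1 - W u * W u)%C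
        (fun u => RtoC (1 / alpha / 2) * (q u / u))%C).
      * apply (cderiv_minus (fun _ => RtoC 1) (fun u => W u * W u)%C).
        apply cderiv_const. apply (cderiv_mult W W); apply DW; auto.
      * apply (cderiv_mult (fun _ => RtoC (1 / alpha / 2)) (fun u => q u / u)%C).
        apply cderiv_const. apply (cderiv_div q (fun u => u)); auto. exact Hm. apply cderiv_id.
    + intros u Hu. apply cayley_mod; auto.
    (* As [|W z0| = 1], [Cconj (W z0) (1 - W z0^2) = - 2 i Im (W z0)], so Jack's quantity is
       [- i Im (W z0) q z0 / alpha]. It is real and at least 1, which gives [Re (q z0) = 0] and
       [Im (W z0) Im (q z0) >= alpha], hence [|Im (q z0)| >= alpha]. *)
    + assert (EA : (Cconj (W z0) * (z0 * W1 z0))%C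
        = (RtoC (1 / alpha / 2) * (Cconj (W z0) - W z0) * q z0)%C).
      { assert (E1 : (Cconj (W z0) * W z0)%C = RtoC 1).
        { rewrite Cmult_comm, <- Cmod2_conj, HW1. f_equal. ring. }
        unfold W1. transitivity
          ((Cconj (W z0) - (Cconj (W z0) * W z0) * W z0) * (RtoC (1 / alpha / 2) * q z0))%C.
        field; auto. rewrite E1. ring. }
      rewrite EA in JI, JR.
      assert (HR : Re (RtoC (1 / alpha / 2) * (Cconj (W z0) - W z0) * q z0)%C
        = Im (W z0) * Im (q z0) / alpha).
      { generalize (W z0) (q z0); intros [a b] [x y]; unfold Re, Im; simpl. field. lra. }
      assert (HI : Im (RtoC (1 / alpha / 2) * (Cconj (W z0) - W z0) * q z0)%C
        = - (Im (W z0) * Re (q z0) / alpha)).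
      { generalize (W z0) (q z0); intros [a b] [x y]; unfold Re, Im; simpl. field. lra. }
      rewrite HR in JR. rewrite HI in JI. clear HR HI.
      apply Rle_div_r in JR; [|lra].
      assert (NI : Im (W z0) <> 0) by (intros E; rewrite E in JR; lra).
      assert (Q0 : Re (q z0) = 0).
      { apply Rmult_eq_reg_l with (Im (W z0) / alpha).
        unfold Rdiv in *. lra. unfold Rdiv. apply Rmult_integral_contrapositive_currified; auto.
        apply Rinv_neq_0_compat. lra. }
      specialize (Hslit z0 ltac:(unfold r in *; lra) Q0).
      pose proof (im_le_Cmod (W z0)) as X. rewrite HW1 in X.
      pose proof (Rle_abs (Im (W z0) * Im (q z0))) as Y. rewrite Rabs_mult in Y.
      pose proof (Rabs_pos (Im (W z0))). pose proof (Rabs_pos (Im (q z0))). nra.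
Qed.

Lemma sector_subordinate :
  subordinate p (fun z : C => Cpower ((1 + z) / (1 - z))%C alpha).
Proof.
  pose proof PI_RGT_0 as HPI.
  assert (Hpi : alpha * (PI / 2) <= PI / 2) by nra.
  assert (Sl : forall z, Cmod z < 1 -> slit (p z)).
  { intros z Hz. left. apply Carg_lt_half; auto. pose proof (sector_bound z Hz). lra. }
  assert (RePos : forall z, Cmod z < 1 -> 0 < Re (Cpower (p z) (1 / alpha))).
  { intros z Hz. pose proof (sector_bound z Hz). apply Re_Cpower_sector; lra. }
  split; [|split].
  - intros z Hz. exists (dp z). apply cderiv_is_derive. auto.
  - intros z Hz. unfold in_disc in Hz.
    assert (N : (1 - z)%C <> RtoC 0).
    { intros E. assert (z = RtoC 1).
      { transitivity (RtoC 1 - (RtoC 1 - z))%C. ring. rewrite E. ring. }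
      rewrite H, Cmod_1 in Hz. lra. }
    (* The real part is [(1 - |z|^2) / |1 - z|^2]. *)
    assert (Hs : slit ((1 + z) / (1 - z))%C).
    { left. set (D := sqmod (1 - z)%C).
      assert (HD : 0 < D) by (apply sqmod_pos; auto).
      replace (Re ((1 + z) / (1 - z))%C) with ((1 - Cmod z ^ 2) / D).
      - apply Rdiv_lt_0_compat; auto. pose proof (Cmod_ge_0 z). simpl. nra.
      - rewrite Cmod2_alt. unfold D, sqmod, Re, Im in *; simpl in *. field.
        intros E. apply (Rlt_irrefl 0). unfold D, sqmod, Re, Im in HD; simpl in HD. nra. }
    eexists. apply cderiv_is_derive.
    apply (cderiv_comp (fun u => Cpower u alpha) (fun z => (1 + z) / (1 - z))%C).
    + apply cderiv_Cpower. exact Hs.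
    + apply (cderiv_div (fun z => 1 + z)%C (fun z => 1 - z)%C).
      apply (cderiv_plus (fun _ => RtoC 1) (fun z => z)). apply cderiv_const. apply cderiv_id.
      apply (cderiv_minus (fun _ => RtoC 1) (fun z => z)). apply cderiv_const. apply cderiv_id.
      exact N.
  - exists W. split; [|split; [|split]].
    + intros z Hz. destruct (cderiv_W_sector z Hz (Sl z Hz)) as [l Hl].
      left. apply sector_bound; auto. exists l. apply cderiv_is_derive; auto.
    + intros z Hz. specialize (RePos z Hz). apply cayley_mod; lra.
    + apply W_0.
    + intros z Hz. unfold W. rewrite cayley_inv.
      * symmetry. pose proof (sector_bound z Hz) as X. apply Rabs_lt_between in X.
        apply Cpower_Cpower; auto; [|field; lra].
        assert (Hi : 0 < 1 / alpha) by (apply Rdiv_lt_0_compat; lra).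
        assert (E1 : 1 / alpha * (alpha * (PI / 2)) = PI / 2) by (field; lra).
        nra.
      * specialize (RePos z Hz). apply cayley_den. lra.
Qed.

End Sector.

Theorem theorem3p1 (alpha beta : R) (p : C -> C)
    (halpha : 0 < alpha <= 1)
    (hp : analytic_on_disc p)
    (hp0 : p (RtoC 0) = RtoC 1)
    (hsub : subordinate
              (fun z : C => (1 + RtoC beta * (z * C_derive p z / p z))%C)
              phi_CAR)
    (hbeta : Rabs beta >=
               1 / alpha * sqrt ((4 * sqrt 3 + 8) / (3 * sqrt 3))) :
  subordinate p (fun z : C => Cpower ((1 + z) / (1 - z))%C alpha).
Proof.
  set (K2 := (4 * sqrt 3 + 8) / (3 * sqrt 3)) in *.
  assert (Hs3 : 0 < sqrt 3) by (apply sqrt_lt_R0; lra).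
  assert (HK2 : 1 < K2).
  { unfold K2. apply Rlt_div_r; lra. }
  assert (HK : 1 < sqrt K2).
  { rewrite <- sqrt_1. apply sqrt_lt_1; lra. }
  assert (Hab : sqrt K2 <= alpha * Rabs beta).
  { apply Rge_le in hbeta. apply (Rmult_le_compat_l alpha) in hbeta; [|lra].
    replace (alpha * (1 / alpha * sqrt K2)) with (sqrt K2) in hbeta by (field; lra). lra. }
  (* With [|beta| > 1], the bound [|beta q| <= 2] yields [|q| <= 2], as the nonvanishing of [p]
     requires. *)
  assert (Hb : 1 < Rabs beta) by nra.
  assert (Nb : beta <> 0) by (intros ->; rewrite Rabs_R0 in Hb; lra).
  assert (NbC : RtoC beta <> RtoC 0) by (intros E; apply RtoC_inj in E; auto).
  destruct hsub as [hPhi [_ [w [_ [hw [_ hPw]]]]]].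
  set (q := fun z => (z * C_derive p z / p z)%C).
  assert (Eq : forall z, Cmod z < 1 -> (RtoC beta * q z)%C = (phi_CAR (w z) - RtoC 1)%C).
  { intros z Hz. rewrite <- (hPw z Hz). unfold q. ring. }
  assert (Dp : forall z, Cmod z < 1 -> cderiv p z (C_derive p z)).
  { intros z Hz. apply cderiv_is_derive. apply C_derive_correct; auto. }
  assert (Hpn : forall z, Cmod z < 1 -> p z <> RtoC 0).
  { apply (log_derivative_bounded_nonzero p (C_derive p)); auto.
    - intros z Hz. fold (q z). pose proof (phi_CAR_bound (w z) (hw z Hz)) as X.
      rewrite <- (Eq z Hz), Cmod_mult, Cmod_R in X. pose proof (Cmod_ge_0 (q z)). nra.
    - rewrite hp0. intros E; apply RtoC_inj in E; lra. }
  apply (sector_subordinate alpha p (C_derive p) q); auto.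
  - intros z Hz. unfold q. field. auto.
  (* The subordination includes that [1 + beta q] is analytic; solving for [q] makes [q]
     differentiable. *)
  - intros z Hz. destruct (hPhi z Hz) as [l Hl]. apply cderiv_is_derive in Hl.
    eexists. apply (cderiv_ext_loc (fun u => / RtoC beta *
      ((1 + RtoC beta * (u * C_derive p u / p u)) - 1))%C q z _ 1); [lra| |].
    + intros u _. fold (q u). field. auto.
    + apply (cderiv_mult (fun _ => / RtoC beta)%C
        (fun u => (1 + RtoC beta * (u * C_derive p u / p u)) - 1)%C).
      apply cderiv_const.
      apply (cderiv_minus (fun u => 1 + RtoC beta * (u * C_derive p u / p u))%C (fun _ => RtoC 1)).
      exact Hl. apply cderiv_const.
  - intros z Hz H0.
    assert (ER : Re (RtoC beta * q z)%C = beta * Re (q z))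
      by (unfold Re, Im; generalize (q z); intros [x y]; simpl; ring).
    assert (EI : Im (RtoC beta * q z)%C = beta * Im (q z))
      by (unfold Re, Im; generalize (q z); intros [x y]; simpl; ring).
    rewrite Eq in ER, EI by auto.
    pose proof (phi_CAR_axis (w z) (hw z Hz)) as X. rewrite ER, EI, H0 in X.
    specialize (X ltac:(ring)). fold K2 in X.
    rewrite <- (sqrt_sqrt K2) in X by lra.
    (* If [|Im (q z)| >= alpha], then [|beta Im (q z)| >= alpha |beta| >= sqrt K2], against the
       strict bound of [phi_CAR_axis]. *)
    apply Rnot_le_lt. intros H1.
    assert (Y : sqrt K2 <= Rabs beta * Rabs (Im (q z))) by nra.
    rewrite <- Rabs_mult in Y.
    assert (Z : sqrt K2 * sqrt K2 <= Rabs (beta * Im (q z)) ^ 2).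
    { rewrite <- Rsqr_pow2. apply Rsqr_incr_1; lra. }
    rewrite pow2_abs in Z. lra.
Qed.
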